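(* For integers $n\ge1$, the proportion of permutations $\sigma\in S_n$ such that every positive integer below $n$ can be expressed as a sum of lengths of distinct cycles of $\sigma$ equals $$\frac{C}{n}\left(1+O\left(\frac1n\right)\right),$$ where $C=(1-e^{-\gamma})^{-1}=2.280291\ldots$ and $\gamma$ is Euler's constant.
   Context: $S_n$ is the symmetric group on $\{1,\dots,n\}$; cycles in the disjoint cycle decomposition include fixed points (cycles of length 1). *)

(* Defs.v *)
From HB Require Import structures.
From mathcomp Require Import all_boot all_order all_algebra all_fingroup.
From mathcomp Require Import all_classical all_reals all_analysis.
Set Implicit Arguments.
Unset Strict Implicit.
Unset Printing Implicit Defensive.

Import Order.TTheory GRing.Theory Num.Theory.
Import numFieldNormedType.Exports.

Local Open Scope ring_scope.

(* [series harmonic n] is 1 + 1/2 + ... + 1/n. *)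
Definition euler_gamma (R : realType) : R :=
  lim ((fun n : nat => series (@harmonic R) n - ln n%:R) @ \oo)%classic.

Definition constC (R : realType) : R := (1 - expR (- euler_gamma R))^-1.

(* Distinct cycles may have equal lengths, so the sum ranges over a set of
   cycles (the orbits of s, fixed points included), not over a set of
   lengths. *)
Definition sum_of_cycle_lengths (n : nat) (s : 'S_n) (m : nat) : bool :=
  [exists A : {set {set 'I_n}},
    (A \subset porbits s) && (m == \sum_(c in A) #|c|)%N].

Definition all_below_sums (n : nat) (s : 'S_n) : bool :=
  [forall m : 'I_n, (0 < m)%N ==> sum_of_cycle_lengths s m].

Definition proportion (R : realType) (n : nat) : R :=
  #|[set s : 'S_n | all_below_sums s]%SET|%:R / #|{: 'S_n}|%:R.

(* Main.v *)
(** Sort the cycle lengths of a permutation of n points.  Every integer below n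
    is a sum of distinct cycle lengths iff, for each m < n, the cycles of length
    at most m + 1 cover more than m points.  Let p(n) be the proportion of such
    permutations and q(k, y) the proportion of permutations of k points without
    cycles of length at most y.  Splitting at the first gap m gives
      sum_(m <= n) p(m) q(n - m, m + 1) = 1,
    and summing these identities over n gives
      sum_(m <= M - 2) p(m) q(M, m + 1) = 1 - 1/M.
    With N = n + 1 and M = ceil(N/2), their difference is the renewal equation
      p(n) = 1/M + sum_(0 < y < M) p(y - 1) (q(M, y) - q(N - y, y)).
    Put p(n) = C/(n + 1) + e(n).  Two facts about the kernel K = q(M, y) - q(N - y, y)
    yield e(n) = O(1/n^2) by induction:
    - sum_y K/y = 1/N - (1 - exp(-gamma))/M + O(1/N^2), obtained by sorting
      permutations by the number of their shortest cycles, with the limit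
      q(k, y) -> exp(-H_y) as k grows;
    - sum_y |K|/y^2 <= 0.9/N^2 for large N, obtained from enclosures of y q(k, y)
      on the grid k = i y/64, computed from k (q(k+1, y) - q(k, y)) =
      q(k - y, y) - q(k+1, y).
    The digits of C come from the Euler-Maclaurin enclosure of gamma at n = 64. *)

From Stdlib Require Import NArith.
Require Import Defs.
From HB Require Import structures.
From mathcomp Require Import all_boot all_order all_algebra all_fingroup.
From mathcomp Require Import all_classical all_reals all_analysis.
From mathcomp Require Import zify ring lra.
Set Implicit Arguments.
Unset Strict Implicit.
Unset Printing Implicit Defensive.
Import Order.TTheory GRing.Theory Num.Theory.
Import numFieldNormedType.Exports.
Local Open Scope ring_scope.

(** * Cycle types of uniform permutations *)

Definition cycle_type n (s : 'S_n) : seq nat :=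
  [seq #|pred_of_set c| | c <- enum (porbits s)].

Definition perm_invariant (T : Type) (F : seq nat -> T) :=
  forall l l' : seq nat, perm_eq l l' -> F l = F l'.

(* Chinese restaurant process: the new point 0 is inserted after [x] in its cycle,
   or fixed if [x] is 0. *)
Definition insert_perm n (s : 'S_n) (x : 'I_n.+1) : 'S_n.+1 :=
  (tperm ord0 x * lift_perm ord0 ord0 s)%g.

Lemma insert_perm_inj n :
  injective (fun sx : 'S_n * 'I_n.+1 => insert_perm sx.1 sx.2).
Proof.
move=> [s x] [s' x'] /= E.
have Ex (r : 'S_n) z : insert_perm r z z = ord0.
  by rewrite permM tpermR lift_perm_id.
have xx' : x = x'.
  by apply: (@perm_inj _ (insert_perm s x)); rewrite Ex {1}E Ex.
move: E; rewrite /insert_perm xx' => /mulgI E; congr pair.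
apply/permP => k; apply: (@lift_inj _ ord0).
by rewrite -!(lift_perm_lift ord0 ord0) E.
Qed.

Lemma big_insert_perm (R : nmodType) n (G : 'S_n.+1 -> R) :
  \sum_(t : 'S_n.+1) G t = \sum_(s : 'S_n) \sum_(x : 'I_n.+1) G (insert_perm s x).
Proof.
rewrite pair_big /=.
rewrite (reindex (fun sx : 'S_n * 'I_n.+1 => insert_perm sx.1 sx.2)) //=.
apply: onW_bij; apply: inj_card_bij; first exact: insert_perm_inj.
by rewrite card_prod card_ord !card_Sn factS mulnC.
Qed.

Lemma porbit_closed (T : finType) (s : {perm T}) (x : T) (B : {set T}) :
  x \in B -> (forall z, z \in B -> s z \in B) -> porbit s x \subset B.
Proof.
move=> xB sB; apply/fintype.subsetP => y /porbitP [i ->].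
by elim: i => [|i IH]; rewrite ?expg0 ?perm1 // expgSr permM sB.
Qed.

Lemma mem_porbit_next (T : finType) (s : {perm T}) (x z : T) :
  z \in porbit s x -> s z \in porbit s x.
Proof. by move=> /porbitP [i ->]; rewrite -permM -expgSr mem_porbit. Qed.

Definition insert_cycle n (i : 'I_n) (c : {set 'I_n}) : {set 'I_n.+1} :=
  (lift ord0 @: c :|: (if i \in c then [set ord0] else finset.set0))%SET.

Lemma mem_insert_cycle_lift n (i k : 'I_n) c :
  (lift ord0 k \in insert_cycle i c) = (k \in c).
Proof.
rewrite !inE mem_imset; last exact: lift_inj.
by case: ifP; rewrite !inE ?orbF.
Qed.

Lemma mem_insert_cycle0 n (i : 'I_n) c :
  (ord0 \in insert_cycle i c) = (i \in c).
Proof.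
rewrite !inE; have -> : (ord0 \in [set lift ord0 k | k in c]%SET) = false.
  by apply/negbTE/imsetP => -[k _ /eqP]; apply/negP/neq_lift.
by case: ifP; rewrite inE.
Qed.

Lemma insert_cycle_inj n (i : 'I_n) : injective (insert_cycle i).
Proof.
move=> c c' E; apply/finset.setP => k.
by rewrite -(mem_insert_cycle_lift i) E mem_insert_cycle_lift.
Qed.

Lemma card_insert_cycle n (i : 'I_n) c :
  #|insert_cycle i c| = (#|c| + (i \in c))%N.
Proof.
rewrite /insert_cycle; case: ifP => ic; last first.
  by rewrite finset.setU0 card_imset ?addn0 //; exact: lift_inj.
rewrite finset.setUC cardsU1 card_imset; last exact: lift_inj.
suff -> : ord0 \notin [set lift ord0 k | k in c]%SET by rewrite addnC.
by apply/imsetP => -[k _ /eqP]; apply/negP/neq_lift.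
Qed.

Lemma insert_perm_lift n (s : 'S_n) i k : k != i ->
  insert_perm s (lift ord0 i) (lift ord0 k) = lift ord0 (s k).
Proof.
move=> ki; rewrite permM tpermD ?lift_perm_lift ?neq_lift //.
by rewrite eq_sym (inj_eq (@lift_inj _ _)).
Qed.

Lemma insert_perm_at n (s : 'S_n) i :
  insert_perm s (lift ord0 i) (lift ord0 i) = ord0.
Proof. by rewrite permM tpermR lift_perm_id. Qed.

Lemma insert_perm_0 n (s : 'S_n) i :
  insert_perm s (lift ord0 i) ord0 = lift ord0 (s i).
Proof. by rewrite permM tpermL lift_perm_lift. Qed.

Lemma porbit_insert_perm n (s : 'S_n) i k :
  porbit (insert_perm s (lift ord0 i)) (lift ord0 k) =
  insert_cycle i (porbit s k).
Proof.
set t := insert_perm _ _; apply/eqP; rewrite finset.eqEsubset; apply/andP; split.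
  apply: porbit_closed => [|z]; first by rewrite mem_insert_cycle_lift porbit_id.
  case: (unliftP ord0 z) => [y|] ->.
    rewrite mem_insert_cycle_lift => yk.
    have [yi|yi] := eqVneq y i.
      by rewrite yi insert_perm_at mem_insert_cycle0 -yi.
    by rewrite insert_perm_lift // mem_insert_cycle_lift mem_porbit_next.
  rewrite mem_insert_cycle0 insert_perm_0 mem_insert_cycle_lift.
  exact: mem_porbit_next.
have main y : y \in porbit s k -> lift ord0 y \in porbit t (lift ord0 k).
  move=> /porbitP [j ->]; elim: j => [|j IH].
    by rewrite expg0 perm1 porbit_id.
  rewrite expgSr permM; set z := (s ^+ j)%g k in IH *.
  have [zi|zi] := eqVneq z i; last first.
    by rewrite -(insert_perm_lift s zi) mem_porbit_next.
  have := mem_porbit_next (mem_porbit_next IH).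
  by rewrite -/t zi insert_perm_at insert_perm_0.
apply/fintype.subsetP => z; case: (unliftP ord0 z) => [y|] ->.
  by rewrite mem_insert_cycle_lift; exact: main.
by rewrite mem_insert_cycle0 => /main /mem_porbit_next; rewrite insert_perm_at.
Qed.

Lemma porbits_insert_perm n (s : 'S_n) i :
  porbits (insert_perm s (lift ord0 i)) = (insert_cycle i @: porbits s)%SET.
Proof.
have orb0 : porbit (insert_perm s (lift ord0 i)) ord0 =
    porbit (insert_perm s (lift ord0 i)) (lift ord0 i).
  apply/eqP; rewrite eq_porbit_mem -{1}(insert_perm_at s i).
  by apply: mem_porbit_next; rewrite porbit_id.
apply/finset.setP => c; apply/imsetP/imsetP => -[].
  move=> x _ ->; case: (unliftP ord0 x) => [k|] ->.
    by exists (porbit s k); rewrite ?porbit_insert_perm // imset_f.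
  by exists (porbit s i); rewrite ?orb0 ?porbit_insert_perm // imset_f.
move=> _ /imsetP [k _ ->] ->.
by exists (lift ord0 k); rewrite ?porbit_insert_perm.
Qed.

Lemma porbits_insert_fixed n (s : 'S_n) :
  porbits (insert_perm s ord0) =
  ([set ord0] |: (fun c : {set 'I_n} => lift ord0 @: c) @: porbits s)%SET.
Proof.
have E k : insert_perm s ord0 (lift ord0 k) = lift ord0 (s k).
  by rewrite permM tperm1 perm1 lift_perm_lift.
have E0 : insert_perm s ord0 ord0 = ord0 by rewrite permM tperm1 perm1 lift_perm_id.
have P0 : porbit (insert_perm s ord0) ord0 = [set ord0]%SET.
  apply/eqP; rewrite finset.eqEsubset finset.sub1set porbit_id andbT.
  by apply: porbit_closed => [|z]; rewrite !inE // => /eqP ->; rewrite E0.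
have P k : porbit (insert_perm s ord0) (lift ord0 k) = (lift ord0 @: porbit s k)%SET.
  apply/eqP; rewrite finset.eqEsubset; apply/andP; split.
    apply: porbit_closed => [|z]; first by rewrite imset_f ?porbit_id.
    by move=> /imsetP [y yk ->]; rewrite E imset_f ?mem_porbit_next.
  apply/fintype.subsetP => _ /imsetP [y /porbitP [j ->] ->].
  elim: j => [|j IH]; first by rewrite expg0 perm1 porbit_id.
  by rewrite expgSr permM -E mem_porbit_next.
apply/finset.setP => c; rewrite !inE; apply/imsetP/orP.
  move=> [x _ ->]; case: (unliftP ord0 x) => [k|] ->.
    by right; apply/imsetP; exists (porbit s k); rewrite ?P // imset_f.
  by left; rewrite P0.
case=> [/eqP ->|/imsetP [_ /imsetP [k _ ->] ->]].
  by exists ord0; rewrite ?P0.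
by exists (lift ord0 k); rewrite ?P.
Qed.

Lemma enum_imset (T U : finType) (f : T -> U) (A : {set T}) :
  injective f -> perm_eq (enum (f @: A)%SET) (map f (enum A)).
Proof.
move=> fI; apply: uniq_perm; rewrite ?enum_uniq ?map_inj_uniq ?enum_uniq //.
move=> y; rewrite mem_enum; apply/imsetP/mapP => -[x xA ->]; exists x => //.
  by rewrite mem_enum.
by rewrite -mem_enum.
Qed.

Lemma cycle_type_insert n (s : 'S_n) i :
  perm_eq (cycle_type (insert_perm s (lift ord0 i)))
          [seq (#|pred_of_set c| + (i \in c))%N | c <- enum (porbits s)].
Proof.
rewrite /cycle_type porbits_insert_perm.
rewrite (perm_trans (perm_map _ (enum_imset _ (@insert_cycle_inj _ i)))) //.
by rewrite -map_comp (eq_map (fun c => card_insert_cycle i c)).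
Qed.

Lemma cycle_type_fixed n (s : 'S_n) :
  perm_eq (cycle_type (insert_perm s ord0)) (1%N :: cycle_type s).
Proof.
rewrite /cycle_type porbits_insert_fixed.
set h := fun c : {set 'I_n} => _.
have hI : injective h by apply: imset_inj; exact: lift_inj.
have N0 : [set ord0]%SET \notin (h @: porbits s)%SET.
  apply/imsetP => -[c _ /finset.setP /(_ ord0)].
  rewrite inE eqxx => /esym /imsetP [k _ /eqP].
  by apply/negP/neq_lift.
have : perm_eq (enum ([set ord0] |: (h @: porbits s))%SET)
         ([set ord0]%SET :: map h (enum (porbits s))).
  rewrite (@perm_trans _ ([set ord0]%SET :: enum (h @: porbits s)%SET)) //.
    apply: uniq_perm; rewrite ?enum_uniq //= ?mem_enum ?N0 ?enum_uniq //.
    by move=> c; rewrite mem_enum !inE mem_enum.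
  by rewrite perm_cons enum_imset.
move=> /(perm_map (fun c : {set 'I_n.+1} => #|pred_of_set c|)) /perm_trans -> //=.
rewrite cards1 perm_cons -map_comp.
by under eq_map do rewrite /= (card_imset _ (@lift_inj _ _)).
Qed.

Lemma perm_rem (T : eqType) (x : T) (l l' : seq T) :
  perm_eq l l' -> perm_eq (rem x l) (rem x l').
Proof.
move=> ll'; have [xl|xl] := boolP (x \in l); last first.
  by rewrite !rem_id // -(perm_mem ll').
rewrite -(perm_cons x) -(permPl (perm_to_rem xl)).
by rewrite -(permPr (perm_to_rem _)) // -(perm_mem ll').
Qed.

Lemma sum_porbits (R : nmodType) n (s : 'S_n) (G : 'I_n -> R) :
  \sum_i G i = \sum_(c in porbits s) \sum_(i in c) G i.
Proof.
rewrite (partition_big (porbit s) (mem (porbits s))) /=; last first.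
  by move=> i _; rewrite imset_f.
apply: eq_bigr => _ /imsetP [k _ ->]; apply: eq_bigl => i.
by rewrite eq_porbit_mem porbit_sym.
Qed.

Lemma perm_map_incr (T : eqType) (l : seq T) (f : T -> nat) (c : T) :
  uniq l -> c \in l ->
  perm_eq [seq (f d + (d == c))%N | d <- l] ((f c).+1 :: rem (f c) (map f l)).
Proof.
move=> ul cl; have pl := perm_to_rem cl.
rewrite (perm_trans (perm_map _ pl)) //= eqxx addn1 perm_cons.
have -> : [seq (f d + (d == c))%N | d <- rem c l] = map f (rem c l).
  apply/eq_in_map => d; rewrite mem_rem_uniq // inE => /andP [/negbTE -> _].
  by rewrite addn0.
have := perm_rem (f c) (perm_map f pl); rewrite /= eqxx.
by rewrite perm_sym.
Qed.

Definition grow_sum (R : pzSemiRingType) (F : seq nat -> R) (l : seq nat) : R :=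
  F (1%N :: l) + \sum_(c <- l) c%:R * F (c.+1 :: rem c l).

Lemma cycle_type_sum (R : pzSemiRingType) n (F : seq nat -> R) : perm_invariant F ->
  \sum_(t : 'S_n.+1) F (cycle_type t) = \sum_(s : 'S_n) grow_sum F (cycle_type s).
Proof.
move=> FP; rewrite big_insert_perm; apply: eq_bigr => s _.
rewrite big_ord_recl; congr (_ + _); first exact: FP (cycle_type_fixed s).
under eq_bigr => i _ do rewrite (FP _ _ (cycle_type_insert s i)).
rewrite (sum_porbits s) big_map big_enum /=; apply: eq_bigr => c cs.
transitivity (\sum_(i in c) F (#|c|.+1 :: rem #|c| (cycle_type s))); last first.
  by rewrite sumr_const mulr_natl.
apply: eq_bigr => i ic; apply: FP.
rewrite -(permPr (perm_map_incr _ _ _)) ?enum_uniq ?mem_enum //.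
rewrite (@eq_in_map _ _ _ (fun d : {set 'I_n} => #|d| + (d == c))%N _).1 //.
move=> d; rewrite mem_enum => /imsetP [k _ ->].
move: cs ic => /imsetP [k' _ ->].
by rewrite porbit_sym -!eq_porbit_mem => /eqP <-; rewrite eq_sym.
Qed.

Lemma sumn_cycle_type n (s : 'S_n) : sumn (cycle_type s) = n.
Proof.
rewrite sumnE big_map big_enum /= -[RHS]card_ord -sum1_card (sum_porbits s).
by apply: eq_bigr => c _; rewrite sum1_card.
Qed.

Lemma grow_sum_cons (R : pzSemiRingType) (F : seq nat -> R) j l :
  perm_invariant F ->
  grow_sum F (j :: l) = grow_sum (F \o cons j) l + j%:R * F (j.+1 :: l).
Proof.
move=> FP; rewrite /grow_sum big_cons /= eqxx -addrA; congr (_ + _).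
  by apply: FP; rewrite (perm_catCA [:: 1%N] [:: j] l).
rewrite addrC; congr (_ + _).
rewrite [in LHS]big_seq [in RHS]big_seq; apply: eq_bigr => c cl.
congr (_ * _); apply: FP; have [jc|jc] := eqVneq j c.
  rewrite perm_sym (perm_catCA [:: j] [:: c.+1] (rem c l)) perm_cons perm_sym.
  by rewrite jc perm_to_rem.
by rewrite (perm_catCA [:: c.+1] [:: j] (rem c l)).
Qed.

Lemma perm_invariant_cons (T : Type) (F : seq nat -> T) j :
  perm_invariant F -> perm_invariant (F \o cons j).
Proof. by move=> FP l l' ll'; apply: FP; rewrite perm_cons. Qed.

Lemma perm_invariant_grow (R : pzSemiRingType) (F : seq nat -> R) :
  perm_invariant F -> perm_invariant (grow_sum F).
Proof.
move=> FP l l' ll'; rewrite /grow_sum; congr (_ + _).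
  exact: perm_invariant_cons ll'.
rewrite (perm_big _ ll'); apply: eq_bigr => c _; congr (_ * _).
by apply: FP; rewrite perm_cons perm_rem.
Qed.

Definition cycle_sum (R : pzSemiRingType) n (F : seq nat -> R) : R :=
  \sum_(s : 'S_n) F (cycle_type s).

Lemma cycle_sum0 (R : pzSemiRingType) (F : seq nat -> R) : cycle_sum 0 F = F [::].
Proof.
rewrite /cycle_sum (eq_bigr (fun=> F [::])) => [|s _].
  by rewrite sumr_const [X in _ *+ X](card_Sn 0).
congr F; apply: size0nil; rewrite size_map -cardE; apply: eq_card0 => c.
by apply/negbTE/imsetP => -[[]].
Qed.

Lemma cycle_sum_rec (R : pzSemiRingType) n (F : seq nat -> R) : perm_invariant F ->
  cycle_sum n.+1 F = \sum_(j < n.+1) (n ^_ j)%:R * cycle_sum (n - j) (F \o cons j.+1).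
Proof.
elim: n F => [|n IH] F FP.
  rewrite big_ord1 /= mul1r subnn /cycle_sum cycle_type_sum //.
  by rewrite -![\sum_(s : 'S_0) _]/(cycle_sum 0 _) !cycle_sum0 /grow_sum big_nil addr0.
rewrite {1}/cycle_sum cycle_type_sum // -/(cycle_sum n.+1 (grow_sum F)).
rewrite IH; last exact: perm_invariant_grow.
pose a j := cycle_sum (n.+1 - j) (F \o cons j.+1).
transitivity (\sum_(j < n.+1) (n ^_ j)%:R * (a j + j.+1%:R * a j.+1)).
  apply: eq_bigr => j _; congr (_ * _).
  rewrite /a subSS subSn -1?ltnS // {1}/cycle_sum.
  under eq_bigr do rewrite /= grow_sum_cons //.
  rewrite big_split /= -mulr_sumr; congr (_ + _).
  by rewrite {1}/cycle_sum cycle_type_sum //; exact: perm_invariant_cons.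
under eq_bigr do rewrite mulrDr mulrA -natrM.
rewrite big_split /= -/(a _) [RHS](eq_bigr (fun j : 'I_n.+2 => (n.+1 ^_ j)%:R * a j)) //.
rewrite [RHS]big_ord_recl [X in X + _]big_ord_recl !ffactn0 -addrA; congr (_ + _).
transitivity (\sum_(j < n.+1) (n ^_ j.+1)%:R * a j.+1 +
   \sum_(j < n.+1) (n ^_ j * j.+1)%:R * a j.+1).
  congr (_ + _); rewrite [RHS]big_ord_recr /= ffact_small // mul0r addr0.
  exact: eq_bigr.
rewrite -big_split /=; apply: eq_bigr => j _; rewrite -mulrDl -natrD.
congr (_%:R * _); rewrite /bump /= add1n ffactSS ffactnSr.
by rewrite -mulnDr mulnC; congr (_ * _)%N; have := ltn_ord j; lia.
Qed.

Definition cycle_mean (R : realType) n (F : seq nat -> R) : R :=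
  cycle_sum n F / n`!%:R.

Lemma cycle_mean0 (R : realType) (F : seq nat -> R) : cycle_mean 0 F = F [::].
Proof. by rewrite /cycle_mean cycle_sum0 divr1. Qed.

Lemma eq_cycle_mean (R : realType) n (F G : seq nat -> R) :
  (forall l, sumn l = n -> F l = G l) -> cycle_mean n F = cycle_mean n G.
Proof.
move=> FG; rewrite /cycle_mean /cycle_sum; congr (_ / _).
by apply: eq_bigr => s _; rewrite FG // sumn_cycle_type.
Qed.

Lemma cycle_mean_rec (R : realType) n (F : seq nat -> R) : perm_invariant F ->
  n%:R * cycle_mean n F = \sum_(j < n) cycle_mean (n - j.+1) (F \o cons j.+1).
Proof.
case: n => [|n] FP; first by rewrite mul0r big_ord0.
rewrite /cycle_mean cycle_sum_rec // mulr_suml mulr_sumr.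
apply: eq_bigr => j _; rewrite subSS.
have jn : (j <= n)%N by rewrite -ltnS.
have := ffact_fact jn => /(congr1 (fun k => k%:R : R)); rewrite natrM => E.
have n0 : n.+1%:R != 0 :> R by rewrite pnatr_eq0.
have f0 k : (k`!)%:R != 0 :> R by rewrite pnatr_eq0 -lt0n fact_gt0.
rewrite factS natrM -E; have := f0 n; rewrite -E mulf_eq0 negb_or => /andP [? ?].
by field; rewrite ?n0 ?f0 //; apply/and3P; split.
Qed.

Lemma cycle_mean_sum (R : realType) n (I : Type) (r : seq I) (P : pred I)
    (F : I -> seq nat -> R) :
  cycle_mean n (fun l => \sum_(i <- r | P i) F i l) =
  \sum_(i <- r | P i) cycle_mean n (F i).
Proof. by rewrite /cycle_mean /cycle_sum exchange_big mulr_suml. Qed.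

Lemma cycle_mean_1 (R : realType) n : cycle_mean n (fun=> 1) = 1 :> R.
Proof.
rewrite /cycle_mean /cycle_sum sumr_const [X in _ *+ X](card_Sn n) divff //.
Qed.

Lemma cycle_mean_zero (R : realType) n : cycle_mean n (fun=> 0) = 0 :> R.
Proof. by rewrite /cycle_mean /cycle_sum big1 ?mul0r. Qed.

Definition long_prop (R : realType) n y : R :=
  cycle_mean n (fun l => (all (fun c => y < c)%N l)%:R).

Definition short_sum y (l : seq nat) := (\sum_(c <- l | (c <= y)%N) c)%N.

Lemma perm_invariant_all (R : realType) (a : pred nat) :
  perm_invariant (fun l => (all a l)%:R : R).
Proof. by move=> l l' ll'; rewrite (perm_all _ ll'). Qed.

Lemma long_prop0 (R : realType) y : long_prop R 0 y = 1.
Proof. by rewrite /long_prop cycle_mean0. Qed.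

Lemma long_prop_rec (R : realType) n y :
  n%:R * long_prop R n y =
  \sum_(j < n | (y < j.+1)%N) long_prop R (n - j.+1) y.
Proof.
rewrite cycle_mean_rec; last exact: perm_invariant_all.
rewrite [RHS]big_mkcond; apply: eq_bigr => j _; case: ifP => yj.
  by apply: eq_cycle_mean => l _ /=; rewrite yj.
by rewrite -[RHS](cycle_mean_zero R (n - j.+1)); apply: eq_cycle_mean => l _ /=; rewrite yj.
Qed.

Lemma perm_invariant_split (R : realType) y m (F : seq nat -> R) :
  perm_invariant F ->
  perm_invariant (fun l => F [seq c <- l | (c <= y)%N] * (short_sum y l == m)%:R).
Proof.
move=> FP l l' ll'; rewrite (FP _ _ (perm_filter _ ll')).
by rewrite /short_sum (perm_big _ ll').
Qed.

Lemma cycle_mean_split (R : realType) y n m (F : seq nat -> R) : perm_invariant F ->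
  cycle_mean n (fun l => F [seq c <- l | (c <= y)%N] * (short_sum y l == m)%:R) =
  (if (m <= n)%N then
     cycle_mean m (fun l => F l * (all (fun c => c <= y)%N l)%:R) *
     long_prop R (n - m) y
   else 0).
Proof.
elim/ltn_ind: n m F => n IH m F FP.
have [n0|n0] := posnP n.
  rewrite n0 cycle_mean0 /= /short_sum big_nil; case: m => [|m] /=; last by rewrite mulr0.
  by rewrite cycle_mean0 long_prop0 !mulr1.
apply: (@mulfI _ n%:R); first by rewrite pnatr_eq0 -lt0n.
rewrite cycle_mean_rec; last exact: perm_invariant_split.
have step (j : 'I_n) :
  cycle_mean (n - j.+1) ((fun l => F [seq c <- l | (c <= y)%N] *
     (short_sum y l == m)%:R) \o cons j.+1) =
  (if (j.+1 <= y)%N then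
     if (j.+1 <= m <= n)%N then
       cycle_mean (m - j.+1) (fun l => F (j.+1 :: l) * (all (fun c => c <= y)%N l)%:R)
         * long_prop R (n - m) y
     else 0
   else if (m <= n - j.+1)%N then
     cycle_mean m (fun l => F l * (all (fun c => c <= y)%N l)%:R)
       * long_prop R (n - j.+1 - m) y else 0).
  have jn : (n - j.+1 < n)%N by have := ltn_ord j; lia.
  case: ifP => jy; last first.
    rewrite -(IH _ jn) //; apply: eq_cycle_mean => l _ /=.
    by rewrite jy /short_sum big_cons jy.
  have [jm|jm] /= := leqP j.+1 m; last first.
    rewrite -[RHS](cycle_mean_zero R (n - j.+1)); apply: eq_cycle_mean => l _ /=.
    by rewrite /short_sum big_cons jy; case: eqP => [?|]; rewrite ?mulr0 //; lia.
  have := IH _ jn (m - j.+1)%N _ (perm_invariant_cons j.+1 FP).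
  rewrite (_ : (m - j.+1 <= n - j.+1)%N = (m <= n)%N); last by have := ltn_ord j; lia.
  rewrite (_ : n - j.+1 - (m - j.+1) = n - m)%N; last by have := ltn_ord j; lia.
  move=> <-; apply: eq_cycle_mean => l _ /=; rewrite jy /short_sum big_cons jy.
  by congr (_ * _%:R); congr nat_of_bool; apply/eqP/eqP; lia.
rewrite (eq_bigr _ (fun j _ => step j)).
have [mn|mn] := leqP m n; last first.
  rewrite mulr0 big1 // => j _; case: ifP => _; first by rewrite andbF.
  by rewrite leqNgt (leq_ltn_trans _ mn) ?leq_subr.
rewrite (bigID (fun j : 'I_n => (j.+1 <= y)%N)) /=.
set E := cycle_mean m _; set Q := long_prop _ _ _.
have -> : n%:R * (E * Q) = m%:R * E * Q + E * ((n - m)%:R * Q).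
  by rewrite natrB //; ring.
congr (_ + _).
  rewrite cycle_mean_rec; last first.
    by move=> l l' ll'; rewrite (FP _ _ ll') (perm_all _ ll').
  rewrite (big_ord_widen_cond _ xpredT
    (fun j => cycle_mean (m - j.+1) ((fun l => F l * (all (fun c => c <= y)%N l)%:R) \o cons j.+1)) mn).
  rewrite mulr_suml [LHS]big_mkcond [RHS]big_mkcond; apply: eq_bigr => j _ /=.
  case: (boolP (j.+1 <= y)%N) => jy; rewrite ?andbT; case: ifP => // jm.
    congr (_ * _); apply: eq_cycle_mean => l _ /=; by rewrite jy.
  rewrite [X in _ = X * _](_ : _ = 0) ?mul0r //.
  rewrite -[RHS](cycle_mean_zero R (m - j.+1)); apply: eq_cycle_mean => l _ /=.
  by rewrite (negbTE jy) mulr0.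
rewrite long_prop_rec.
rewrite (big_ord_widen_cond _ (fun j => (y < j.+1)%N)
  (fun j => long_prop R (n - m - j.+1) y) (leq_subr m n)).
rewrite mulr_sumr [LHS]big_mkcond [RHS]big_mkcond; apply: eq_bigr => j _ /=.
rewrite (_ : (m <= n - j.+1)%N = (j < n - m)%N); last by have := ltn_ord j; lia.
case: (leqP j.+1 y) => //= _; case: ifP => // _.
by congr (_ * long_prop _ _ _); lia.
Qed.

(** * The first gap *)

(* If the parts of size at most [m + 1] have total at most [m], then [m + 1] is not
   a sum of parts. *)
Definition practical (l : seq nat) :=
  all (fun m => m < short_sum m.+1 l)%N (iota 0 (sumn l)).

Lemma practicalP l :
  reflect (forall m, (m < sumn l)%N -> (m < short_sum m.+1 l)%N) (practical l).
Proof.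
apply: (iffP allP) => H m; first by move=> ml; apply: H; rewrite mem_iota.
by rewrite mem_iota add0n => /H.
Qed.

Lemma perm_short_sum y l l' : perm_eq l l' -> short_sum y l = short_sum y l'.
Proof. exact: perm_big. Qed.

Lemma perm_sumn l l' : perm_eq l l' -> sumn l = sumn l'.
Proof. by rewrite !sumnE; exact: perm_big. Qed.

Lemma perm_invariant_practical (R : realType) :
  perm_invariant (fun l => (practical l)%:R : R).
Proof.
move=> l l' ll'; congr (_%:R); congr nat_of_bool.
by apply/practicalP/practicalP => H m; move/(_ m): H;
  rewrite (perm_sumn ll') (perm_short_sum _ ll').
Qed.

Lemma short_sum_le y y' l : (y <= y')%N -> (short_sum y l <= short_sum y' l)%N.
Proof.
move=> yy'; rewrite /short_sum big_mkcond [X in (_ <= X)%N]big_mkcond.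
apply: leq_sum => c _.
by case: ifP => // cy; rewrite (leq_trans cy yy').
Qed.

Lemma short_sum_le_sumn y l : (short_sum y l <= sumn l)%N.
Proof. by rewrite sumnE /short_sum big_mkcond leq_sum // => c _; case: ifP. Qed.

Lemma mem_le_sumn c (l : seq nat) : c \in l -> (c <= sumn l)%N.
Proof. by move=> cl; rewrite sumnE (big_rem c) //= leq_addr. Qed.

Lemma short_sum_full y l : (sumn l <= y)%N -> short_sum y l = sumn l.
Proof.
move=> ly; rewrite /short_sum big_seq_cond sumnE [RHS]big_seq.
apply: eq_bigl => c; case: (boolP (c \in l)) => //= cl.
exact: leq_trans (mem_le_sumn cl) ly.
Qed.

Lemma sumn_filter y l : sumn [seq c <- l | (c <= y)%N] = short_sum y l.
Proof. by rewrite sumnE big_filter. Qed.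

Lemma short_sum_filter y y' l : (y' <= y)%N ->
  short_sum y' [seq c <- l | (c <= y)%N] = short_sum y' l.
Proof.
move=> yy'; rewrite /short_sum big_filter_cond; apply: eq_bigl => c.
by case: (leqP c y') => cy'; rewrite ?andbF // andbT (leq_trans cy').
Qed.

(* A cycle type splits uniquely at its first gap [m]: the parts of length at
   most [m + 1] form a practical type of total [m]. *)
Lemma first_gap l :
  (\sum_(m < (sumn l).+1)
     (practical [seq c <- l | (c <= m.+1)%N] && (short_sum m.+1 l == m)))%N = 1%N.
Proof.
have ex : exists m, (short_sum m.+1 l <= m)%N.
  by exists (sumn l); rewrite short_sum_full.
case: (ex_minnP ex) => m gap min_m.
have lt_gap k : (k < m)%N -> (k < short_sum k.+1 l)%N.
  by move=> km; rewrite ltnNge; apply/negP => /min_m; rewrite leqNgt km.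
have sm : short_sum m.+1 l = m.
  apply/eqP; rewrite eqn_leq gap /=; case: (m) lt_gap => // k /(_ k (ltnSn k)) h.
  exact: leq_trans h (short_sum_le _ _).
have ml : (m < (sumn l).+1)%N by rewrite ltnS -{1}sm short_sum_le_sumn.
rewrite (bigD1 (Ordinal ml)) //= sm eqxx andbT big1 ?addn0 => [|k].
  suff -> : practical [seq c <- l | (c <= m.+1)%N] by [].
  apply/practicalP => k; rewrite sumn_filter sm => km.
  by rewrite short_sum_filter ?lt_gap //; lia.
rewrite -val_eqE /= => km; apply/eqP; rewrite eqb0; apply/negP => /andP [pk /eqP sk].
have mk : (m < k)%N by rewrite ltn_neqAle eq_sym km min_m // sk.
move/practicalP: pk => /(_ m); rewrite sumn_filter sk => /(_ mk).
by rewrite short_sum_filter ?sm ?ltnn //; lia.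
Qed.

Definition practical_prop (R : realType) n : R :=
  cycle_mean n (fun l => (practical l)%:R).

Lemma first_gap_sum (R : realType) n :
  \sum_(m < n.+1) practical_prop R m * long_prop R (n - m) m.+1 = 1.
Proof.
rewrite -(cycle_mean_1 R n).
transitivity (cycle_mean n (fun l => \sum_(m < n.+1)
   ((practical [seq c <- l | (c <= m.+1)%N])%:R * (short_sum m.+1 l == m)%:R : R))).
  rewrite cycle_mean_sum; apply: eq_bigr => m _.
  rewrite (@cycle_mean_split R m.+1 n m (fun l => (practical l)%:R)); last first.
    exact: perm_invariant_practical.
  rewrite -ltnS ltn_ord; congr (_ * _); apply: eq_cycle_mean => l lm.
  rewrite (_ : all _ l) ?mulr1 //; apply/allP => c /mem_le_sumn.
  by rewrite lm => /leqW.
apply: eq_cycle_mean => l <-; rewrite -[RHS](_ : 1%:R = 1) // -(first_gap l).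
by rewrite natr_sum; apply: eq_bigr => m _; rewrite -natrM mulnb.
Qed.

Lemma subset_sums (T : finType) (w : T -> nat) (X : {set T}) :
  (forall m, m < \sum_(c in X) w c ->
     m < \sum_(c in X | w c <= m.+1) w c)%N ->
  forall v, (v <= \sum_(c in X) w c)%N ->
  exists2 A : {set T}, A \subset X & v = (\sum_(c in A) w c)%N.
Proof.
have [k] := ubnP #|X|; elim: k X => // k IH X Xk HX v vX.
have [X0|[c0 c0X]] := set_0Vmem X.
  exists finset.set0; first exact: finset.sub0set.
  by move: vX; rewrite X0 !big_set0 leqn0 => /eqP.
case: (arg_maxnP w c0X) => c cX0 maxc; have cX : c \in X := cX0.
pose X' := (X :\ c)%SET.
have X'k : (#|X'| < k)%N by rewrite (cardsD1 c X) cX in Xk.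
have totX : (\sum_(d in X) w d = w c + \sum_(d in X') w d)%N.
  rewrite (bigD1 c) //=; congr addn; apply: eq_bigl => d.
  by rewrite !inE andbC.
have HX' m : (m < \sum_(d in X') w d)%N -> (m < \sum_(d in X' | w d <= m.+1) w d)%N.
  move=> mX'; have [cm|mc] := leqP (w c) m.+1.
    rewrite (eq_bigl (mem X')) // => d; rewrite -[RHS]/(d \in X').
    case: (boolP (d \in X')) => //.
    rewrite !inE => /andP [_ dX]; exact: leq_trans (maxc _ dX) cm.
  have := HX m; rewrite totX => /(_ (leq_trans mX' (leq_addl _ _))).
  rewrite (eq_bigl (fun d => (d \in X') && (w d <= m.+1)%N)) // => d.
  rewrite !inE; have [->|//] := eqVneq d c.
  by rewrite leqNgt mc /= andbF.
have sub (A : {set T}) : A \subset X' -> A \subset X.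
  by move=> AX'; apply: fintype.subset_trans AX' _; exact: finset.subD1set.
have [vX'|X'v] := leqP v (\sum_(d in X') w d)%N.
  by have [A AX' ->] := IH _ X'k HX' v vX'; exists A => //; exact: sub.
have cX' : ((w c).-1 <= \sum_(d in X') w d)%N.
  case E : (w c) => [|[|m]] //=.
  have := HX m; rewrite totX E => /(_ ltac:(lia)) /leq_trans; apply.
  rewrite [X in (X <= _)%N]big_mkcond [X in (_ <= X)%N]big_mkcond.
  apply: leq_sum => d _; rewrite !inE; have [->|dc /=] := eqVneq d c.
    by rewrite E ltnn andbF.
  by case: (d \in X) => //=; case: ifP.
have [A AX' vA] := IH _ X'k HX' (v - w c)%N ltac:(lia).
have cA : c \notin A.
  by apply/negP => /(fintype.subsetP AX'); rewrite !inE eqxx.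
exists (c |: A)%SET; first by rewrite finset.subUset finset.sub1set cX sub.
by rewrite big_setU1 //= -vA; lia.
Qed.

Lemma all_below_sumsE n (s : 'S_n) : all_below_sums s = practical (cycle_type s).
Proof.
have tot : (\sum_(c in porbits s) #|c| = n)%N.
  by rewrite -[RHS](sumn_cycle_type s) sumnE big_map big_enum.
have short y : short_sum y (cycle_type s) = (\sum_(c in porbits s | (#|c| <= y)%N) #|c|)%N.
  by rewrite /short_sum big_map big_enum_cond.
apply/forallP/practicalP => [H m|H m]; rewrite ?sumn_cycle_type ?short in H *.
  move=> mn; have [mn'|nm] := ltnP m.+1 n.
    have /existsP [A /andP [AX /eqP /= mA]] := implyP (H (Ordinal mn')) (ltn0Sn m).
    rewrite [X in (X <= _)%N]mA big_mkcond [X in (_ <= X)%N]big_mkcond.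
    apply: leq_sum => c _; case: ifP => // cA.
    rewrite (fintype.subsetP AX _ cA) /= mA (bigD1 c) //=.
    by rewrite leq_addr.
  rewrite (eq_bigl (mem (porbits s))) ?tot // => c.
  rewrite -[RHS]/(c \in porbits s).
  case: (boolP (c \in porbits s)) => //= cs; apply: leq_trans nm.
  by rewrite -[X in (_ <= X)%N](card_ord n) max_card.
apply/implyP => m0; apply/existsP.
have sums k : (k < \sum_(c in porbits s) #|c|)%N ->
    (k < \sum_(c in porbits s | (#|c| <= k.+1)%N) #|c|)%N.
  by rewrite tot -short; exact: H.
have mt : (m <= \sum_(c in porbits s) #|c|)%N by rewrite tot ltnW.
have [A AX mA] := subset_sums sums mt.
by exists A; rewrite AX; apply/eqP.
Qed.

Lemma proportionE (R : realType) n : proportion R n = practical_prop R n.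
Proof.
rewrite /proportion /practical_prop /cycle_mean card_Sn; congr (_ / _).
rewrite -sum1_card natr_sum /cycle_sum big_mkcond; apply: eq_bigr => s _.
by rewrite inE all_below_sumsE; case: (practical _).
Qed.

(** * Permutations without short cycles *)

Lemma long_prop_ge0 (R : realType) k y : 0 <= long_prop R k y.
Proof.
rewrite /long_prop /cycle_mean /cycle_sum divr_ge0 ?ler0n // sumr_ge0 // => s _.
Qed.

Lemma long_prop_prefix (R : realType) k y :
  k%:R * long_prop R k y = \sum_(i < k - y) long_prop R i y.
Proof.
rewrite long_prop_rec (reindex_inj rev_ord_inj) /=.
rewrite (big_ord_widen_cond k xpredT (fun i => long_prop R i y) (leq_subr y k)).
apply: eq_big => [i|i _]; last by congr long_prop; have := ltn_ord i; lia.
by have := ltn_ord i; lia.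
Qed.

Lemma long_propS (R : realType) k y :
  k.+1%:R * long_prop R k.+1 y =
  k%:R * long_prop R k y + (if (y <= k)%N then long_prop R (k - y) y else 0).
Proof.
rewrite !long_prop_prefix; case: leqP => yk; first by rewrite subSn // big_ord_recr.
by rewrite addr0 (_ : k.+1 - y = k - y)%N //; lia.
Qed.

Lemma long_prop_short (R : realType) k y :
  (0 < k)%N -> (k <= y)%N -> long_prop R k y = 0.
Proof.
move=> k0 ky; apply/eqP; have := long_prop_prefix R k y.
rewrite (_ : (k - y = 0)%N); last by lia.
by rewrite big_ord0 => /eqP; rewrite mulf_eq0 pnatr_eq0 -[k == 0%N]negbK -lt0n k0.
Qed.

Lemma long_prop_single (R : realType) k y :
  (y < k)%N -> (k <= y.*2.+1)%N -> long_prop R k y = k%:R^-1.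
Proof.
move=> yk k2y; have k0 : k%:R != 0 :> R by rewrite pnatr_eq0; lia.
apply: (mulfI k0); rewrite divff // long_prop_prefix.
have -> : (k - y = (k - y).-1.+1)%N by lia.
rewrite big_ord_recl long_prop0 big1 ?addr0 // => i _.
by rewrite long_prop_short //= /bump /=; have := ltn_ord i; lia.
Qed.

Lemma long_prop_avg (R : realType) k y : (y <= k)%N ->
  long_prop R k.+1 y - long_prop R k y =
  (long_prop R (k - y) y - long_prop R k y) / k.+1%:R.
Proof.
move=> yk; have := long_propS R k y; rewrite yk => E.
have k0 : k.+1%:R != 0 :> R by rewrite pnatr_eq0.
apply: (mulIf k0); rewrite divfK // mulrBl mulrC E -natr1; ring.
Qed.

Lemma long_prop_hull (R : realType) K y (lo hi : R) :
  (forall k, (K <= k <= K + y)%N -> lo <= long_prop R k y <= hi) ->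
  forall k, (K <= k)%N -> lo <= long_prop R k y <= hi.
Proof.
move=> H; elim/ltn_ind => k IH Kk.
have [kK|Kyk] := leqP k (K + y)%N; first by apply: H; rewrite Kk.
case: k IH Kk Kyk => [|k] IH Kk Kyk; first by lia.
have yk : (y <= k)%N by lia.
have /andP [l1 h1] := IH k (ltnSn k) ltac:(lia).
have /andP [l2 h2] := IH (k - y)%N ltac:(lia) ltac:(lia).
have := long_propS R k y; rewrite yk => E.
have k0 : 0 < k.+1%:R :> R by rewrite ltr0n.
have k0' : 0 <= k%:R :> R by rewrite ler0n.
rewrite -(ler_pM2l k0) -[X in _ && X](ler_pM2l k0) E -natr1 !mulrDl !mul1r.
by rewrite !lerD // ler_wpM2l.
Qed.

Lemma long_prop_le (R : realType) k y : (0 < k)%N -> long_prop R k y <= y.+1%:R^-1.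
Proof.
move=> k0; have [] // := andP (@long_prop_hull R 1 y 0 y.+1%:R^-1 _ k k0) => {k k0} k.
move=> /andP [k0 k1]; rewrite long_prop_ge0 /=.
have [ky|yk] := leqP k y; first by rewrite long_prop_short // invr_ge0 ler0n.
rewrite long_prop_single //; last by rewrite -addnn; lia.
by rewrite lef_pV2 ?posrE ?ltr0n // ler_nat.
Qed.

Lemma long_prop_osc_window (R : realType) K y (B : R) :
  (forall k k', (K <= k <= K + y)%N -> (K <= k' <= K + y)%N ->
     `|long_prop R k y - long_prop R k' y| <= B) ->
  forall k k', (K <= k)%N -> (K <= k')%N ->
     `|long_prop R k y - long_prop R k' y| <= B.
Proof.
move=> win.
have mid i k : (K <= i <= K + y)%N -> (K <= k)%N ->
    long_prop R i y - B <= long_prop R k y <= long_prop R i y + B.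
  by move=> iw; apply: long_prop_hull => j jw; rewrite -ler_distl win.
move=> k k' Kk Kk'.
have := @long_prop_hull R K y (long_prop R k' y - B) (long_prop R k' y + B) _ k Kk.
rewrite -ler_distl; apply => j jw.
by rewrite -ler_distl distrC ler_distl mid.
Qed.

Lemma long_prop_osc_step (R : realType) K y (v : R) :
  (forall k k', (K <= k)%N -> (K <= k')%N ->
     `|long_prop R k y - long_prop R k' y| <= v) ->
  forall k k', (K + y <= k)%N -> (K + y <= k')%N ->
     `|long_prop R k y - long_prop R k' y| <= v * y%:R / (K + y).+1%:R.
Proof.
move=> H; pose B := v * y%:R / (K + y).+1%:R.
have v0 : 0 <= v by apply: le_trans (H K K _ _).
have near d k : (K + y <= k)%N ->
    `|long_prop R (k + d) y - long_prop R k y| <= d%:R * (v / (K + y).+1%:R).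
  move=> Kk; elim: d => [|d IH]; first by rewrite addn0 subrr normr0 mul0r.
  apply: le_trans (ler_distD (long_prop R (k + d) y) _ _) _.
  rewrite -natr1 mulrDl mul1r [X in _ <= X]addrC lerD //.
  rewrite addnS long_prop_avg; last by lia.
  rewrite normrM ler_pM ?normr_ge0 //; first by apply: H; lia.
  rewrite ger0_norm ?invr_ge0 ?ler0n // lef_pV2 ?posrE ?ltr0n // ler_nat; lia.
have win i j : (K + y <= i <= K + y + y)%N -> (K + y <= j <= K + y + y)%N ->
    `|long_prop R i y - long_prop R j y| <= B.
  wlog ij : i j / (j <= i)%N => [W|] iw jw.
    by case: (leqP j i) => [/W|/ltnW/W]; last rewrite distrC; apply.
  rewrite -(subnKC ij); apply: le_trans (near _ _ _) _; first by lia.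
  rewrite /B mulrA [_ * v]mulrC ler_wpM2r ?invr_ge0 ?ler0n // ler_wpM2l // ler_nat.
  by lia.
exact: long_prop_osc_window.
Qed.

Lemma long_prop_osc (R : realType) j y k k' :
  (j * y < k)%N -> (j * y < k')%N ->
  `|long_prop R k y - long_prop R k' y| <= (j`! * y.+1)%:R^-1.
Proof.
elim: j k k' => [|j IH] k k' jk jk'.
  rewrite fact0 mul1n.
  have [l1 h1] := (long_prop_ge0 R k y, @long_prop_le R k y jk).
  have [l2 h2] := (long_prop_ge0 R k' y, @long_prop_le R k' y jk').
  move: l1 h1 l2 h2; move: (_^-1) (long_prop R k y) (long_prop R k' y) => u a b *.
  by rewrite ler_norml; apply/andP; split; lra.
have := @long_prop_osc_step R (j * y).+1 y _ (fun a b => IH a b) k k'.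
rewrite (_ : (j * y).+1 + y = (j.+1 * y).+1)%N; last by lia.
move=> /(_ jk jk') /le_trans; apply.
rewrite -mulrA -ler_pdivlMl ?invr_gt0 ?ltr0n ?muln_gt0 ?fact_gt0 // invrK.
rewrite factS natrM -!mulnA natrM invfM -natrM mulrCA divff ?mulr1; last first.
  by rewrite pnatr_eq0 muln_eq0 negb_or -lt0n fact_gt0.
rewrite ler_pdivrMr ?ltr0n // mulrC ler_pdivlMr ?ltr0n // -natrM ler_nat; lia.
Qed.

Lemma fact_pow5 j : (j.+1 ^ 5 <= 171 * j`!)%N.
Proof.
case: j => [|[|[|j]]] //; elim: j => [|j IH] //.
rewrite factS; apply: leq_trans (_ : j.+4 * j.+4 ^ 5 <= _)%N; last first.
  by rewrite mulnCA leq_mul2l IH orbT.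
by rewrite -expnS !expnS expn0; nia.
Qed.

Lemma long_prop_osc_pow (R : realType) K y k k' :
  (0 < y)%N -> (0 < K)%N -> (K <= k)%N -> (K <= k')%N ->
  `|long_prop R k y - long_prop R k' y| <= 171 * y%:R ^+ 4 / K%:R ^+ 5.
Proof.
move=> y0 K0 Kk Kk'; pose j := (K.-1 %/ y)%N.
have jK : (j * y < K)%N by have := leq_trunc_div K.-1 y; rewrite -/j; lia.
have Kj : (K <= j.+1 * y)%N by have := ltn_ceil K.-1 y0; rewrite -/j; lia.
apply: le_trans (@long_prop_osc R j y k k' ltac:(lia) ltac:(lia)) _.
have K0' : 0 < K%:R ^+ 5 :> R by rewrite exprn_gt0 // ltr0n.
rewrite ler_pdivlMr // -ler_pdivlMl ?invr_gt0 ?ltr0n ?muln_gt0 ?fact_gt0 // invrK.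
rewrite -!natrX -!natrM ler_nat.
apply: leq_trans (_ : (j.+1 * y) ^ 5 <= _)%N; first by rewrite leq_exp2r.
rewrite expnMn; apply: leq_trans (leq_mul (fact_pow5 j) (leqnn _)) _.
have : (y <= y.+1)%N by []; rewrite (expnSr y 4); nia.
Qed.

Lemma le_div_nat_eq0 (R : realType) (x C : R) :
  (forall N : nat, (0 < N)%N -> x <= C / N%:R) -> x <= 0.
Proof.
move=> H; rewrite leNgt; apply/negP => x0.
pose N := (Num.truncn (`|C| / x)).+1.
have := H N (ltn0Sn _); rewrite ler_pdivlMr ?ltr0n // leNgt => /negP; apply.
rewrite mulrC -ltr_pdivrMr //; apply: le_lt_trans (truncnS_gt _).
by rewrite ler_wpM2r ?invr_ge0 ?(ltW x0) // ler_norm.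
Qed.

Lemma cauchy_rate (R : realType) (u : nat -> R) (C : R) :
  (forall N k k', (0 < N)%N -> (N <= k)%N -> (N <= k')%N -> `|u k - u k'| <= C / N%:R) ->
  exists l : R, forall (b : R) N k, (N <= k)%N ->
    (forall k k', (N <= k)%N -> (N <= k')%N -> `|u k - u k'| <= b) -> `|u k - l| <= b.
Proof.
move=> H; have cu : cvgn u.
  apply/cauchy_cvgP; apply: cauchy_exP => e e0.
  pose N := (Num.truncn (`|C| / e)).+1; exists (u N); exists N => // n /= Nn.
  rewrite /ball /=; apply: le_lt_trans (H N _ _ _ _ _) _ => //.
  rewrite ltr_pdivrMr ?ltr0n // mulrC -ltr_pdivrMr //.
  apply: le_lt_trans (truncnS_gt _).
  by rewrite ler_wpM2r ?invr_ge0 ?(ltW e0) // ler_norm.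
exists (limn u) => b N k Nk Hb.
have : ((fun n => `|u k - u n|) @ \oo --> `|u k - limn u|)%classic.
  by apply: cvg_norm; apply: cvgB cu; exact: cvg_cst.
move=> /cvgr_to_le; apply; exists N => // n /= Nn; exact: Hb.
Qed.

Lemma sum_inv_sqr (R : realType) a b : (0 < a)%N ->
  \sum_(a <= i < b) (i.+1%:R ^+ 2)^-1 <= a%:R^-1 :> R.
Proof.
move=> a0; have [ab|ba] := leqP a b; last first.
  by rewrite big_geq ?invr_ge0 ?ler0n // ltnW.
suff : \sum_(a <= i < b) (i.+1%:R ^+ 2)^-1 <= a%:R^-1 - b%:R^-1 :> R.
  by move/le_trans; apply; rewrite lerBlDr lerDl invr_ge0 ler0n.
rewrite -(subnKC ab); elim: (b - a)%N => [|d IH].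
  by rewrite addn0 big_geq // subrr.
rewrite addnS big_nat_recr ?leq_addr //=.
have d0 : 0 < (a + d)%:R :> R by rewrite ltr0n; lia.
apply: le_trans (lerD IH (lexx _)) _; rewrite -addrA lerD2l -lerBrDl.
rewrite -natr1; set x := (a + d)%:R in d0 *.
rewrite (_ : _ - _ = (x * (x + 1))^-1); last by field; lra.
by rewrite lef_pV2 ?posrE; nra.
Qed.

Lemma invfact_le (R : realType) i : i`!%:R^-1 <= 171 / i.+1%:R ^+ 5 :> R.
Proof.
rewrite ler_pdivlMr ?exprn_gt0 ?ltr0n // mulrC ler_pdivrMr ?ltr0n ?fact_gt0 //.
by rewrite -natrX -natrM ler_nat fact_pow5.
Qed.

Lemma exp_tail (R : realType) (x : R) a b : 0 <= x <= 1 -> (0 < a)%N ->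
  \sum_(a <= i < b) x ^+ i / i`!%:R <= 171 / a%:R ^+ 4.
Proof.
move=> /andP [x0 x1] a0; have a0' : 0 < a%:R :> R by rewrite ltr0n.
apply: le_trans (_ : \sum_(a <= i < b) 171 / a%:R ^+ 3 * (i.+1%:R ^+ 2)^-1 <= _).
  rewrite ler_sum_nat // => i /andP [ai _].
  apply: le_trans (_ : 1 * i`!%:R^-1 <= _).
    by rewrite ler_wpM2r ?invr_ge0 ?ler0n // exprn_ile1.
  rewrite mul1r; apply: le_trans (invfact_le R i) _.
  rewrite -mulrA ler_wpM2l // -invfM lef_pV2 ?posrE ?mulr_gt0 ?exprn_gt0 ?ltr0n //.
  by rewrite -[5%N]/(3 + 2)%N exprD ler_wpM2r ?exprn_ge0 // lerXn2r ?nnegrE // ler_nat; lia.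
rewrite -mulr_sumr; apply: le_trans (_ : 171 / a%:R ^+ 3 * a%:R^-1 <= _).
  by rewrite ler_wpM2l ?sum_inv_sqr // divr_ge0 ?exprn_ge0.
by rewrite -mulrA -invfM -exprSr.
Qed.

Lemma expR_trunc (R : realType) (x : R) B : 0 <= x <= 1 -> (0 < B)%N ->
  `|expR x - \sum_(i < B) x ^+ i / i`!%:R| <= 171 / B%:R ^+ 4.
Proof.
move=> x01 B0; have cv : (series (exp_coeff x) @ \oo --> expR x)%classic.
  exact: is_cvg_series_exp_coeff.
rewrite -(big_mkord xpredT (fun i => x ^+ i / i`!%:R)).
have : ((fun n => `|series (exp_coeff x) n - \sum_(0 <= i < B) x ^+ i / i`!%:R|) @ \oo -->
   `|expR x - \sum_(0 <= i < B) x ^+ i / i`!%:R|)%classic.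
  by apply: cvg_norm; apply: cvgB cv _; exact: cvg_cst.
move=> /cvgr_to_le; apply; exists B => // n /= Bn.
rewrite /series /= (big_cat_nat (leq0n B) Bn) /= addrAC subrr add0r ger0_norm ?exp_tail //.
have /andP [x0 _] := x01.
by rewrite sumr_ge0 // => i _; rewrite divr_ge0 ?exprn_ge0.
Qed.

Definition long_shift (R : realType) n d y : R :=
  if (d <= n)%N then long_prop R (n - d) y else 0.

Lemma long_shiftS (R : realType) n y i :
  (0 < n)%N -> n%:R * long_shift R n (i * y.+1) y.+1 =
  \sum_(j < n | (y.+1 < j.+1)%N) long_shift R (n - j.+1) (i * y.+1) y.+1 +
  (i * y.+1)%:R * long_shift R n (i * y.+1) y.+1.
Proof.
move=> n0; rewrite /long_shift; case: leqP => iyn; last first.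
  rewrite !mulr0 addr0 big1 // => j _; case: leqP => //; have := ltn_ord j; lia.
rewrite -[n%:R](subrK (i * y.+1)%:R) -natrB // mulrDl long_prop_rec; congr (_ + _).
rewrite (big_ord_widen_cond n (fun j => (y.+1 < j.+1)%N)
  (fun j => long_prop R (n - i * y.+1 - j.+1) y.+1) (leq_subr _ _)).
rewrite [LHS]big_mkcond [RHS]big_mkcond; apply: eq_bigr => j _ /=.
case: (y.+1 < j.+1)%N => //=.
rewrite (_ : (i * y.+1 <= n - j.+1)%N = (j < n - i * y.+1)%N); last by have := ltn_ord j; lia.
by case: ifP => // _; congr long_prop; lia.
Qed.

(* Sorting by the number [i] of cycles of length exactly [y + 1]. *)
Lemma long_prop_expand (R : realType) B n y : (n < B)%N ->
  long_prop R n y =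
  \sum_(i < B) long_shift R n (i * y.+1) y.+1 * (y.+1%:R^-1 ^+ i / i`!%:R).
Proof.
case: B => // B; elim/ltn_ind: n => n IH nB; have [->|n0] := posnP n.
  rewrite big_ord_recl /long_shift !long_prop0 expr0 divr1 mulr1 big1 ?addr0 // => i _.
  by rewrite mul0r.
pose w i : R := y.+1%:R^-1 ^+ i / i`!%:R.
have wS i : (i.+1 * y.+1)%:R * w i.+1 = w i.
  rewrite /w factS !natrM exprS.
  have : i`!%:R != 0 :> R by rewrite pnatr_eq0 -lt0n fact_gt0.
  have : y.+1%:R != 0 :> R by rewrite pnatr_eq0.
  have : i.+1%:R != 0 :> R by rewrite pnatr_eq0.
  by move=> ? ? ?; field; do !(apply/andP; split => //).
apply: (@mulfI _ n%:R); first by rewrite pnatr_eq0 -lt0n.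
rewrite long_prop_rec mulr_sumr.
under [RHS]eq_bigr => i _ do rewrite mulrA long_shiftS // mulrDl mulr_suml.
rewrite big_split /= exchange_big /=.
have IHj (j : 'I_n) : long_prop R (n - j.+1) y =
    \sum_(i < B.+1) long_shift R (n - j.+1) (i * y.+1) y.+1 * w i.
  by apply: IH; have := ltn_ord j; lia.
have -> : \sum_(i < B.+1) (i * y.+1)%:R * long_shift R n (i * y.+1) y.+1 * w i =
    if (y < n)%N then long_prop R (n - y.+1) y else 0.
  rewrite big_ord_recl !mul0r add0r.
  under eq_bigr => i _ do rewrite mulrAC wS.
  case: ifP => yn; last first.
    rewrite big1 // => i _; rewrite lift0 /long_shift ifF ?mulr0 //.
    by apply/negbTE; rewrite -ltnNge; nia.
  rewrite (IHj (Ordinal yn)) [RHS]big_ord_recr /= /long_shift.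
  rewrite [X in _ = _ + X](_ : _ = 0) ?addr0; last first.
    by rewrite ifF ?mul0r //; apply/negbTE; rewrite -ltnNge; nia.
  apply: eq_bigr => i _; rewrite mulrC -[bump 0 i]/(i.+1) mulSn; congr (_ * _).
  rewrite (_ : (y.+1 + i * y.+1 <= n)%N = (i * y.+1 <= n - y.+1)%N); last by lia.
  by case: ifP => // _; congr long_prop; lia.
case: ifP => yn.
  rewrite (bigD1 (Ordinal yn)) //= addrC; congr (_ + _).
  apply: eq_big => [j|j _]; last by rewrite IHj.
  by rewrite -val_eqE /=; lia.
rewrite addr0; apply: eq_big => [j|j _]; last by rewrite IHj.
by have := ltn_ord j; lia.
Qed.

Lemma long_prop_lim_fact (R : realType) y (l C : R) :
  (forall N, (0 < N)%N -> `|long_prop R N y - l| <= C / N%:R) ->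
  forall j k, (j * y < k)%N -> `|long_prop R k y - l| <= (j`! * y.+1)%:R^-1.
Proof.
move=> H j k jk; rewrite -subr_le0; apply: (@le_div_nat_eq0 _ _ `|C|) => N N0.
rewrite lerBlDr [X in _ <= X]addrC.
apply: le_trans (ler_distD (long_prop R (N + k) y) _ _) _; apply: lerD.
  by apply: long_prop_osc => //; lia.
apply: le_trans (H _ _) _; first by lia.
apply: le_trans (_ : `|C| / (N + k)%:R <= _).
  by rewrite ler_wpM2r ?invr_ge0 // ler_norm.
by rewrite ler_wpM2l // lef_pV2 ?posrE ?ltr0n ?ler_nat //; lia.
Qed.

Lemma long_shift_approx (R : realType) s (l : R) : (0 < s)%N ->
  (forall j k, (j * s < k)%N -> `|long_prop R k s - l| <= (j`! * s.+1)%:R^-1) ->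
  forall i N, (0 < i)%N -> (0 < N)%N ->
  `|long_shift R N (i * s) s - l| <=
    171 * i.+1%:R ^+ 3 * s%:R ^+ 2 / N%:R ^+ 3 + (N == i * s)%N%:R.
Proof.
move=> s0 H i N i0 N0.
have N3 : 0 < N%:R ^+ 3 :> R by rewrite exprn_gt0 // ltr0n.
have l1 : `|l| <= 2 / s.+1%:R.
  have h := H 0%N 1%N (ltn0Sn _); rewrite fact0 mul1n in h.
  have := @long_prop_le R 1 s (ltn0Sn _); have := long_prop_ge0 R 1 s.
  move: h; rewrite !ler_norml; move: (_^-1) (long_prop R 1 s) => u a /andP [? ?] ? ?.
  by apply/andP; split; lra.
have lN : (N <= i * s)%N -> `|l| <= 171 * i.+1%:R ^+ 3 * s%:R ^+ 2 / N%:R ^+ 3.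
  move=> Nis; apply: le_trans l1 _; rewrite ler_pdivlMr // mulrAC ler_pdivrMr ?ltr0n //.
  rewrite -!natrX -!natrM ler_nat.
  apply: leq_trans (_ : 2 * (i * s) ^ 3 <= _)%N; first by rewrite leq_mul2l leq_exp2r.
  apply: leq_trans (_ : 2 * (i.+1 ^ 3 * s ^ 2 * s.+1) <= _)%N; last by lia.
  rewrite leq_mul2l /= expnMn -mulnA leq_mul ?leq_exp2r //.
  by rewrite (expnSr s 2) leq_mul2l leqnSn orbT.
have [Nis|Nis|Nis] := ltngtP N (i * s)%N.
- by rewrite /long_shift leqNgt Nis /= sub0r normrN addr0 lN // ltnW.
- rewrite addr0 /long_shift (ltnW Nis); pose k := (N - i * s)%N; rewrite -/k.
  pose j := (k.-1 %/ s)%N.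
  have jk : (j * s < k)%N by have := leq_trunc_div k.-1 s; rewrite -/j /k; lia.
  have kj : (k <= j.+1 * s)%N by have := ltn_ceil k.-1 s0; rewrite -/j /k; lia.
  apply: le_trans (H j k jk) _; rewrite ler_pdivlMr //.
  rewrite mulrC ler_pdivrMr ?ltr0n ?muln_gt0 ?fact_gt0 //.
  rewrite -!natrX -!natrM ler_nat.
  apply: leq_trans (_ : (j.+1 * (i.+1 * s)) ^ 3 <= _)%N.
    by rewrite leq_exp2r // /k in kj *; nia.
  have jf : (j.+1 ^ 3 <= 171 * j`!)%N.
    by apply: leq_trans (fact_pow5 j); rewrite leq_pexp2l.
  rewrite expnMn; apply: leq_trans (leq_mul jf (leqnn _)) _.
  rewrite expnMn (expnSr s 2); move: (i.+1 ^ 3)%N (s ^ 2)%N (j`!)%N => b c f.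
  apply: leq_trans (_ : 171 * b * c * (f * s) <= _)%N; first by apply: eq_leq; lia.
  by rewrite !leq_mul.
rewrite /long_shift -Nis leqnn subnn long_prop0 [X in _ <= X]addrC.
by apply: le_trans (ler_normB _ _) _; rewrite normr1 lerD // lN // Nis.
Qed.

Lemma weight_sum (R : realType) s a B : (0 < s)%N -> (0 < a)%N ->
  \sum_(a <= i < B) s%:R^-1 ^+ i / i`!%:R * i.+1%:R ^+ 3 <= 171 / s%:R ^+ a :> R.
Proof.
move=> s0 a0; have s0' : 0 < s%:R :> R by rewrite ltr0n.
have s1 : s%:R^-1 <= 1 :> R by rewrite invf_le1 // ler1n.
have si : 0 <= s%:R^-1 :> R by rewrite invr_ge0 ltW.
apply: le_trans (_ : \sum_(a <= i < B) 171 / s%:R ^+ a * (i.+1%:R ^+ 2)^-1 <= _).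
  rewrite ler_sum_nat // => i /andP [ai _].
  have i3 : 0 < i.+1%:R :> R by rewrite ltr0n.
  rewrite [171 / _]mulrC -!mulrA ler_pM ?exprn_ge0 ?mulr_ge0 ?invr_ge0 ?exprn_ge0 //.
  - by rewrite -exprVn -(subnKC ai) exprD ler_piMr ?exprn_ge0 ?exprn_ile1.
  apply: le_trans (ler_wpM2r _ (invfact_le R i)) _; first by rewrite exprn_ge0 // ltW.
  rewrite [X in X <= _](_ : _ = 171 / i.+1%:R ^+ 2) //.
  by field; rewrite gt_eqF.
rewrite -mulr_sumr ler_piMr // ?divr_ge0 ?exprn_ge0 ?ler0n //.
apply: le_trans (sum_inv_sqr R B a0) _.
by rewrite invf_le1 ?ltr0n // ler1n.
Qed.

Definition long_limit (R : realType) y : R := expR (- series (@harmonic R) y).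

Lemma series_harmonicS (R : realType) y :
  series (@harmonic R) y.+1 = series (@harmonic R) y + y.+1%:R^-1.
Proof. by rewrite /series /= big_nat_recr. Qed.

Lemma long_limit0 (R : realType) : long_limit R 0 = 1.
Proof. by rewrite /long_limit /series /= big_geq // oppr0 expR0. Qed.

Lemma long_limitS (R : realType) y :
  long_limit R y = long_limit R y.+1 * expR y.+1%:R^-1.
Proof. by rewrite /long_limit series_harmonicS opprD -expRD subrK. Qed.

Lemma long_prop_all (R : realType) k : long_prop R k 0 = 1.
Proof.
elim/ltn_ind: k => -[|k] IH; first exact: long_prop0.
apply: (@mulfI _ k.+1%:R); first by rewrite pnatr_eq0.
rewrite long_prop_prefix subn0 mulr1 (eq_bigr (fun=> 1)) => [|i _].
  by rewrite sumr_const card_ord.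
exact: IH.
Qed.

Lemma long_prop_cvg (R : realType) y :
  exists C : R, forall N, (0 < N)%N -> `|long_prop R N y - long_limit R y| <= C / N%:R.
Proof.
elim: y => [|y [C IH]].
  by exists 0 => N _; rewrite long_prop_all long_limit0 subrr normr0 mul0r.
set s := y.+1; have s0 : (0 < s)%N by [].
have s0' : 0 < s%:R :> R by rewrite ltr0n.
have [|l Hl] := @cauchy_rate R (fun k => long_prop R k s) (171 * s%:R ^+ 4).
  move=> N k k' N0 Nk Nk'; apply: le_trans (long_prop_osc_pow R s0 N0 Nk Nk') _.
  rewrite ler_wpM2l ?mulr_ge0 ?exprn_ge0 // lef_pV2 ?posrE ?exprn_gt0 ?ltr0n //.
  by rewrite -natrX ler_nat -{1}(expn1 N) leq_pexp2l.
pose D : R := 171 * s%:R ^+ 4.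
have Hl1 N : (0 < N)%N -> `|long_prop R N s - l| <= D / N%:R.
  move=> N0; apply: (Hl _ N) => // k k' Nk Nk'.
  apply: le_trans (long_prop_osc_pow R s0 N0 Nk Nk') _.
  rewrite ler_wpM2l ?mulr_ge0 ?exprn_ge0 // lef_pV2 ?posrE ?exprn_gt0 ?ltr0n //.
  by rewrite -natrX ler_nat -{1}(expn1 N) leq_pexp2l.
have approx := long_shift_approx s0 (long_prop_lim_fact Hl1).
suff ll : long_limit R y = l * expR s%:R^-1.
  exists D => N N0.
  suff -> : long_limit R s = l by exact: Hl1.
  by apply: (mulIf (lt0r_neq0 (expR_gt0 s%:R^-1))); rewrite -ll -long_limitS.
apply/eqP; rewrite -subr_eq0 -normr_le0.
have l2 : 0 <= `|l| by [].
have [E EE] : exists E : R, E = 171 * (171 * s%:R ^+ 2 + s%:R) by eexists.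
apply: (@le_div_nat_eq0 _ _ (C + D + E + `|l| * 171)) => N N0.
have N0' : 0 < N%:R :> R by rewrite ltr0n.
have NX k : N%:R <= N%:R ^+ k.+1 :> R.
  by rewrite exprS ler_peMr ?ler0n // exprn_ege1 // ler1n.
pose w i : R := s%:R^-1 ^+ i / i`!%:R.
have w0 i : 0 <= w i by rewrite mulr_ge0 ?exprn_ge0 ?invr_ge0 ?ltW.
rewrite (_ : _ - _ = - (long_prop R N y - long_limit R y) +
    \sum_(i < N.+1) (long_shift R N (i * s) s - l) * w i -
    l * (expR s%:R^-1 - \sum_(i < N.+1) w i)); last first.
  rewrite (long_prop_expand R y (ltnSn N)) mulrBr mulr_sumr.
  under [X in _ = _ + X - _]eq_bigr do rewrite mulrBl.
  by rewrite sumrB; ring.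
rewrite 3!mulrDl.
apply: le_trans (ler_normB _ _) _; apply: lerD; last first.
  rewrite normrM -mulrA ler_wpM2l //.
  apply: le_trans (expR_trunc _ (ltn0Sn N)) _.
    by rewrite invr_ge0 ler0n /= invf_le1 // ler1n.
  rewrite ler_wpM2l // lef_pV2 ?posrE ?exprn_gt0 ?ltr0n //.
  by rewrite -natrX ler_nat; apply: leq_trans (leqnSn N) _; rewrite -{1}(expn1 N.+1) leq_pexp2l.
apply: le_trans (ler_normD _ _) _; rewrite normrN -addrA lerD ?IH //.
rewrite big_ord_recl mul0n /w expr0 divr1 mulr1 {1}/long_shift leq0n subn0.
apply: le_trans (ler_normD _ _) _; rewrite lerD ?Hl1 //.
apply: le_trans (ler_norm_sum _ _ _) _.
apply: le_trans (_ : \sum_(1 <= i < N.+1) (171 * s%:R ^+ 2 + s%:R) / N%:R * (w i * i.+1%:R ^+ 3) <= _).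
  rewrite -(big_mkord xpredT (fun i => `|(long_shift R N (i.+1 * s) s - l) * w i.+1|)).
  rewrite [X in _ <= X]big_add1 /= ler_sum_nat // => i _.
  rewrite normrM (ger0_norm (w0 _)) mulrC [X in _ <= X]mulrCA ler_wpM2l //.
  apply: le_trans (approx i.+1 N _ _) _ => //.
  rewrite [X in _ <= X](_ : _ = 171 * i.+2%:R ^+ 3 * s%:R ^+ 2 / N%:R +
     s%:R * i.+2%:R ^+ 3 / N%:R); last by ring.
  apply: lerD.
    rewrite ler_wpM2l ?mulr_ge0 ?exprn_ge0 // lef_pV2 ?posrE ?exprn_gt0 //.
  case: eqP => [->|_]; last by rewrite divr_ge0 ?mulr_ge0 ?exprn_ge0 ?ltW.
  rewrite ler_pdivlMr ?ltr0n ?muln_gt0 // mul1r natrM mulrC ler_wpM2l ?ler0n //.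
  rewrite -natrX ler_nat; apply: leq_trans (leqnSn _) _.
  by rewrite -{1}(expn1 i.+2) leq_pexp2l.
rewrite -mulr_sumr.
apply: le_trans (ler_wpM2l _ (weight_sum R N.+1 s0 (ltn0Sn 0))) _.
  by rewrite divr_ge0 ?addr_ge0 ?mulr_ge0 ?exprn_ge0 ?ltW.
rewrite EE expr1 -[X in _ <= X]mulrA [X in X <= _]mulrC ler_wpM2r //.
by rewrite ler_piMr // invf_le1 // ler1n.
Qed.

Lemma long_prop_lim (R : realType) j y k : (j * y < k)%N ->
  `|long_prop R k y - long_limit R y| <= (j`! * y.+1)%:R^-1.
Proof. by have [C HC] := long_prop_cvg R y; move: j k; apply: long_prop_lim_fact HC. Qed.

(** * The sum of the renewal kernel against 1/y *)

Lemma long_limit_gt0 (R : realType) y : 0 < long_limit R y.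
Proof. exact: expR_gt0. Qed.

Lemma long_limit_le (R : realType) y : long_limit R y <= y.+1%:R^-1.
Proof.
elim: y => [|y IH]; first by rewrite long_limit0 invr1.
have e0 := expR_gt0 (y.+1%:R^-1 : R).
have E := long_limitS R y; rewrite E in IH.
have h : 1 + y.+1%:R^-1 <= expR (y.+1%:R^-1 : R) by exact: expR_ge1Dx.
rewrite -(ler_pM2r e0); apply: le_trans IH _.
apply: le_trans (_ : y.+2%:R^-1 * (1 + y.+1%:R^-1) <= _); last first.
  by rewrite ler_wpM2l ?invr_ge0.
rewrite -(natr1 y.+1); have : 0 < y.+1%:R :> R by rewrite ltr0n.
move: (y.+1%:R) => a a0; rewrite le_eqVlt; apply/orP; left; apply/eqP.
by field; lra.
Qed.

Definition multi_sum (R : realType) P n : R :=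
  \sum_(y < P) \sum_(2 <= i < P.+1)
    long_shift R n (i * y.+1) y.+1 * (y.+1%:R^-1 ^+ i / i`!%:R).

(* Permutations with a unique shortest cycle, sorted by its length; in the
   complement, [multi_sum], the shortest length occurs [i >= 2] times. *)
Lemma unique_shortest (R : realType) P n : (0 < n)%N -> (n <= P)%N ->
  \sum_(y < n) long_prop R (n - y.+1) y.+1 / y.+1%:R = 1 - multi_sum R P n.
Proof.
move=> n0 nP.
have telescope : \sum_(y < P) (long_prop R n y - long_prop R n y.+1) = 1.
  rewrite -(big_mkord xpredT (fun y => long_prop R n y - long_prop R n y.+1)).
  rewrite (@telescope_sumr_eq _ 0 P (fun y => - long_prop R n y)) // => [|k _].
    by rewrite long_prop_all long_prop_short // oppr0 sub0r opprK.
  by rewrite opprK addrC.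
rewrite -[X in _ = X - _]telescope -sumrB.
rewrite (big_ord_widen P (fun y => long_prop R (n - y.+1) y.+1 / y.+1%:R) nP).
rewrite big_mkcond; apply: eq_bigr => y _.
rewrite (@long_prop_expand R P.+1 n y) //.
rewrite -(big_mkord xpredT (fun i => long_shift R n (i * y.+1) y.+1 * (y.+1%:R^-1 ^+ i / i`!%:R))).
rewrite big_ltn // big_ltn; last by lia.
rewrite mul0n mul1n expr0 expr1 !divr1 mulr1 /long_shift leq0n subn0.
by rewrite [in RHS](addrC (long_prop R n y.+1)) !addrK; case: ifP; rewrite ?mul0r.
Qed.

Lemma multi_sum0 (R : realType) P : multi_sum R P 0 = 0.
Proof.
rewrite /multi_sum big1 // => y _; rewrite big_nat big1 // => i /andP [i2 _].
by rewrite /long_shift ifF ?mul0r //; apply/negbTE; rewrite -ltnNge; nia.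
Qed.

Lemma long_prop_div_sum (R : realType) P M : (0 < M)%N -> (M <= P.+1)%N ->
  M%:R * \sum_(y < M.-1) long_prop R M y.+1 / y.+1%:R =
  M%:R - 1 - \sum_(n < M) multi_sum R P n.
Proof.
case: M => // M _ MP; rewrite ltnS in MP.
rewrite [X in _ - X]big_ord_recl multi_sum0 add0r.
have -> : M.+1%:R - 1 = \sum_(n < M) 1 :> R.
  by rewrite sumr_const card_ord -natr1 addrK.
rewrite -sumrB /=.
have U (n : 'I_M) : 1 - multi_sum R P (bump 0 n) =
    \sum_(y < M | (y < n.+1)%N) long_prop R (n.+1 - y.+1) y.+1 / y.+1%:R.
  rewrite -[bump 0 n]/(n.+1) -(@unique_shortest R P) //; last first.
    by apply: leq_trans (ltn_ord n) _.
  by rewrite (big_ord_widen M (fun y => long_prop R (n.+1 - y.+1) y.+1 / y.+1%:R)).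
rewrite [RHS](eq_bigr _ (fun n _ => U n)).
rewrite mulr_sumr [RHS](exchange_big_dep xpredT) //=; apply: eq_bigr => y _.
rewrite mulrA long_prop_prefix -[RHS]mulr_suml.
congr (_ / _).
rewrite (_ : M.+1 - y.+1 = M - y)%N //.
rewrite (eq_bigl (fun n : 'I_M => (y <= n)%N)) //.
rewrite -(big_mkord (fun n => (y <= n)%N) (fun n => long_prop R (n.+1 - y.+1) y.+1)).
have yM : (y <= M)%N by exact: ltnW.
rewrite (big_cat_nat (leq0n y) yM) /= [X in _ = X + _]big1_seq ?add0r; last first.
  by move=> i; rewrite mem_index_iota => /andP [? /andP [_ ?]]; lia.
rewrite big_nat_cond (eq_bigl (fun i => (y <= i < M)%N)) => [|i]; last first.
  by case: (y <= i)%N; rewrite ?andbT.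
rewrite -big_nat -[X in index_iota X M]add0n big_addn big_mkord.
by apply: eq_bigr => i _; congr long_prop; lia.
Qed.

Lemma long_shift_sum (R : realType) M s i : (0 < i)%N ->
  \sum_(n < M) long_shift R n (i * s) s =
  (M%:R - (i.-1 * s)%:R) * long_shift R M (i.-1 * s) s.
Proof.
case: i => // i _ /=; rewrite /long_shift; case: leqP => iM; last first.
  rewrite mulr0 big1 // => n _; rewrite ifF //.
  by apply/negbTE; rewrite -ltnNge mulSn; have := ltn_ord n; lia.
rewrite -natrB // long_prop_prefix.
have -> : (M - i * s - s = M - i.+1 * s)%N by rewrite mulSn; lia.
rewrite -big_mkcond /= -(big_mkord (fun n => (i.+1 * s <= n)%N) (fun n => long_prop R (n - i.+1 * s) s)).
have [iM'|iM'] := leqP (i.+1 * s) M; last first.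
  rewrite (_ : (M - i.+1 * s = 0)%N) ?big_ord0; last by lia.
  by rewrite big1_seq // => n; rewrite mem_index_iota => /andP [? /andP [_ ?]]; lia.
rewrite (big_cat_nat (leq0n _) iM') /= big1_seq ?add0r; last first.
  by move=> n; rewrite mem_index_iota => /andP [? /andP [_ ?]]; lia.
rewrite big_nat_cond (eq_bigl (fun n => (i.+1 * s <= n < M)%N)) => [|n]; last first.
  by case: (i.+1 * s <= n)%N; rewrite ?andbT.
rewrite -big_nat -[X in index_iota X M]add0n big_addn big_mkord.
by apply: eq_bigr => n _; congr long_prop; lia.
Qed.

Lemma multi_term (R : realType) N M s i :
  (0 < s)%N -> (1 < i)%N -> (0 < M)%N -> (M <= N <= M.*2)%N ->
  `|M%:R * long_shift R N (i * s) s -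
    (M%:R - (i.-1 * s)%:R) * long_shift R M (i.-1 * s) s -
    (i.-1 * s)%:R * long_limit R s| <=
  855 * i.+1%:R ^+ 3 * s%:R ^+ 2 / N%:R ^+ 2 + M%:R * (N == i * s)%N%:R.
Proof.
move=> s0 i1 M0 /andP [MN NM].
have approx := long_shift_approx s0 (fun j k => @long_prop_lim R j s k).
set L := long_limit R s in approx *.
have M0' : 0 < M%:R :> R by rewrite ltr0n.
have N0' : 0 < N%:R :> R by rewrite ltr0n; lia.
have MN' : M%:R <= N%:R :> R by rewrite ler_nat.
have NM' : N%:R <= 2 * M%:R :> R by rewrite -natrM ler_nat; lia.
set D : R := i.+1%:R ^+ 3 * s%:R ^+ 2.
have D0 : 0 <= D by rewrite mulr_ge0 ?exprn_ge0.
rewrite (_ : _ - _ = M%:R * (long_shift R N (i * s) s - L) -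
  (M%:R - (i.-1 * s)%:R) * (long_shift R M (i.-1 * s) s - L)); last by ring.
apply: le_trans (ler_normB _ _) _.
have -> : 855 * i.+1%:R ^+ 3 * s%:R ^+ 2 / N%:R ^+ 2 + M%:R * (N == i * s)%N%:R =
  171 * D / N%:R ^+ 2 + M%:R * (N == i * s)%N%:R + 684 * D / N%:R ^+ 2 by rewrite /D; ring.
apply: lerD.
  rewrite normrM (ger0_norm (ltW M0')).
  apply: le_trans (ler_wpM2l (ltW M0') (approx i N _ _)) _; try lia.
  rewrite mulrDr lerD //.
  have -> : M%:R * (171 * i.+1%:R ^+ 3 * s%:R ^+ 2 / N%:R ^+ 3) =
      171 * D / N%:R ^+ 2 * (M%:R / N%:R) by rewrite /D; field; rewrite gt_eqF.
  by rewrite ler_piMr ?divr_ge0 ?mulr_ge0 ?exprn_ge0 // ler_pdivrMr // mul1r.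
apply: le_trans (_ : 171 * D / M%:R ^+ 2 <= _); last first.
  rewrite ler_pdivrMr ?exprn_gt0 // mulrAC ler_pdivlMr ?exprn_gt0 //.
  have : N%:R ^+ 2 <= 4 * M%:R ^+ 2 :> R by nra.
  by move: D D0 => d d0; nra.
have L0 : 0 <= L by exact: ltW (long_limit_gt0 R s).
have i0 : (0 < i)%N by lia.
rewrite normrM; have [iM|Mi] := leqP (i.-1 * s) M; last first.
  rewrite /long_shift leqNgt Mi /= sub0r normrN (ger0_norm L0).
  rewrite ler0_norm ?subr_le0 ?ler_nat ?(ltnW Mi) // opprB.
  apply: le_trans (_ : (i.-1 * s)%:R * s.+1%:R^-1 <= _).
    by rewrite ler_pM ?subr_ge0 ?ler_nat ?(ltnW Mi) ?long_limit_le // lerBlDr lerDl.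
  rewrite ler_pdivlMr ?exprn_gt0 // mulrAC ler_pdivrMr ?ltr0n // /D.
  rewrite -!natrX -!natrM ler_nat.
  apply: leq_trans (_ : (i.-1 * s) * (i.-1 * s) ^ 2 <= _)%N.
    by rewrite leq_mul2l leq_exp2r // (ltnW Mi) orbT.
  apply: leq_trans (_ : (i.+1 ^ 3 * s ^ 2) * s <= _)%N; last by nia.
  rewrite -expnS expnMn (expnSr s) mulnA leq_mul2r; apply/orP; right.
  by rewrite leq_mul2r leq_exp2r //; apply/orP; right; lia.
rewrite -natrB // ger0_norm //.
apply: le_trans (ler_wpM2l (ler0n _ _) (approx i.-1 M _ _)) _; try lia.
rewrite mulrDr [X in _ + X](_ : _ = 0) ?addr0; last first.
  by case: eqP => [->|]; rewrite ?subnn ?mul0r ?mulr0.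
apply: le_trans (_ : M%:R * (171 * i.-1.+1%:R ^+ 3 * s%:R ^+ 2 / M%:R ^+ 3) <= _).
  by rewrite ler_wpM2r ?divr_ge0 ?mulr_ge0 ?exprn_ge0 // ler_nat leq_subr.
rewrite prednK // (_ : M%:R * _ = 171 * (i%:R ^+ 3 * s%:R ^+ 2) / M%:R ^+ 2); last first.
  by field; rewrite gt_eqF.
rewrite ler_wpM2r ?invr_ge0 ?exprn_ge0 // ler_wpM2l // /D.
by rewrite ler_wpM2r ?exprn_ge0 // lerXn2r ?nnegrE // ler_nat.
Qed.

Lemma multi_weight_limit (R : realType) B s : (0 < B)%N ->
  `|\sum_(2 <= i < B.+1) (i.-1 * s.+1)%:R * long_limit R s.+1 *
      (s.+1%:R^-1 ^+ i / i`!%:R) -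
    (s.+1%:R * long_limit R s.+1 - s%:R * long_limit R s)| <= 342 / B%:R ^+ 4.
Proof.
move=> B0; set x : R := s.+1%:R^-1; set L := long_limit R s.+1.
have s0 : 0 < s.+1%:R :> R by rewrite ltr0n.
have x0 : 0 < x by rewrite invr_gt0.
have x1 : x <= 1 by rewrite invf_le1 // ler1n.
have sx : s.+1%:R * x = 1 by rewrite divff // gt_eqF.
pose e k : R := \sum_(i < k) x ^+ i / i`!%:R.
have eE k : `|expR x - e k.+1| <= 171 / k.+1%:R ^+ 4.
  by apply: expR_trunc => //; rewrite (ltW x0).
have main : \sum_(2 <= i < B.+1) (i.-1)%:R * (x ^+ i / i`!%:R) = x * e B - e B.+1 + 1.
  have -> : x * e B = \sum_(0 <= i < B.+1) i%:R * (x ^+ i / i`!%:R).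
    rewrite big_nat_recl // mul0r add0r big_mkord mulr_sumr; apply: eq_bigr => i _.
    rewrite factS natrM exprS.
    have : i`!%:R != 0 :> R by rewrite pnatr_eq0 -lt0n fact_gt0.
    have : i.+1%:R != 0 :> R by rewrite pnatr_eq0.
    by move=> ? ?; field; apply/andP.
  rewrite /e -(big_mkord xpredT (fun i => x ^+ i / i`!%:R)) -sumrB.
  rewrite [in RHS]big_ltn // [in RHS]big_ltn //.
  have -> : 0%:R * (x ^+ 0 / 0`!%:R) - x ^+ 0 / 0`!%:R = -1.
    by rewrite mul0r sub0r expr0 fact0 divr1.
  have -> : 1%:R * (x ^+ 1 / 1`!%:R) - x ^+ 1 / 1`!%:R = 0 by rewrite mul1r subrr.
  rewrite add0r addrAC addNr add0r.
  rewrite [LHS]big_nat [RHS]big_nat; apply: eq_bigr => i /andP [i2 _].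
  by rewrite -[X in _ = _ - X]mul1r -mulrBl -subn1 natrB //; lia.
have -> : \sum_(2 <= i < B.+1) (i.-1 * s.+1)%:R * L * (x ^+ i / i`!%:R) =
    s.+1%:R * L * (x * e B - e B.+1 + 1).
  by rewrite -main mulr_sumr; apply: eq_bigr => i _; rewrite natrM; ring.
have LS : long_limit R s = L * expR x by exact: long_limitS.
have sE : s%:R = s.+1%:R - 1 :> R by rewrite -natr1 addrK.
rewrite (_ : _ - _ = s.+1%:R * L * (expR x - e B.+1) - s.+1%:R * x * L * (expR x - e B)); last first.
  apply/eqP; rewrite -subr_eq0; apply/eqP.
  transitivity ((s.+1%:R * x - 1) * (L * expR x)); last by rewrite sx subrr mul0r.
  rewrite LS sE; clearbody x L; move: (e B) (e B.+1) (expR x) (s.+1%:R) => *; ring.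
rewrite sx mul1r.
have sL : s.+1%:R * L <= 1.
  apply: le_trans (ler_wpM2l (ltW s0) (long_limit_le R s.+1)) _.
  by rewrite ler_pdivrMr ?ltr0n // mul1r ler_nat.
have L0 : 0 <= L by exact: ltW (long_limit_gt0 R _).
have L1 : L <= 1 by apply: le_trans sL; rewrite ler_peMl // ler1n.
apply: le_trans (ler_normB _ _) _; rewrite !normrM (ger0_norm L0) ger0_norm //.
have -> : 342 / B%:R ^+ 4 = 171 / B%:R ^+ 4 + 171 / B%:R ^+ 4 :> R by ring.
apply: lerD.
  apply: le_trans (ler_piMl _ sL) _ => //; apply: le_trans (eE _) _.
  by rewrite ler_wpM2l // lef_pV2 ?posrE ?exprn_gt0 ?ltr0n // lerXn2r ?nnegrE // ler_nat.
apply: le_trans (ler_piMl _ L1) _ => //.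
by case: B B0 {main} => // B _; exact: eE.
Qed.

Lemma sum_indicator (R : realType) n (F : nat -> nat) N (c : R) : 0 <= c ->
  injective F -> \sum_(y < n) c * (N == F y)%:R <= c.
Proof.
move=> c0 Finj; have [/existsP [y0 /eqP Ny0]|] := boolP [exists y : 'I_n, N == F y].
  rewrite (bigD1 y0) //= -Ny0 eqxx mulr1 big1 ?addr0 // => y yy0.
  case: eqP => [NFy|]; rewrite ?mulr0 //.
  case/eqP: yy0; apply: val_inj; apply: Finj.
  by rewrite /= -NFy.
rewrite negb_exists => /forallP H; rewrite big1 // => y _.
by rewrite (negbTE (H y)) mulr0.
Qed.

Lemma multi_sum_main (R : realType) : exists K : R, forall N M,
  (0 < M)%N -> (M <= N <= M.*2)%N ->
  `|M%:R * multi_sum R N N - \sum_(n < M) multi_sum R N n -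
    N%:R * long_limit R N| <= K / N%:R.
Proof.
have [c c0 cE] : exists2 c : R, 0 <= c & c = 855 by exists 855; rewrite ?ler0n.
have [d d0 dE] : exists2 d : R, 0 <= d & d = 342 by exists 342; rewrite ?ler0n.
have [f f0 fE] : exists2 f : R, 0 <= f & f = 171 by exists 171; rewrite ?ler0n.
exists (c * f + f + d) => N M M0 MN; have N0 : (0 < N)%N by lia.
have N0' : 0 < N%:R :> R by rewrite ltr0n.
pose w s i : R := s%:R^-1 ^+ i / i`!%:R.
have w0 s i : 0 <= w s i by rewrite mulr_ge0 ?exprn_ge0 ?invr_ge0.
pose t y i : R := M%:R * long_shift R N (i * y.+1) y.+1 -
    (M%:R - (i.-1 * y.+1)%:R) * long_shift R M (i.-1 * y.+1) y.+1.
have -> : M%:R * multi_sum R N N - \sum_(n < M) multi_sum R N n =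
    \sum_(y < N) \sum_(2 <= i < N.+1) t y i * w y.+1 i.
  rewrite /multi_sum [X in _ - X]exchange_big mulr_sumr -sumrB /=; apply: eq_bigr => y _.
  rewrite [X in _ - X]exchange_big mulr_sumr -sumrB /= [LHS]big_nat [RHS]big_nat.
  apply: eq_bigr => i /andP [i2 _].
  by rewrite -mulr_suml long_shift_sum ?mulrA -?mulrBl //; lia.
have -> : N%:R * long_limit R N =
    \sum_(y < N) (y.+1%:R * long_limit R y.+1 - y%:R * long_limit R y).
  rewrite -(big_mkord xpredT (fun y => y.+1%:R * long_limit R y.+1 - y%:R * long_limit R y)).
  by rewrite (@telescope_sumr _ 0 N (fun y => y%:R * long_limit R y)) // mul0r subr0.
rewrite -sumrB.
pose g y i : R := (i.-1 * y.+1)%:R * long_limit R y.+1.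
have -> : \sum_(y < N) (\sum_(2 <= i < N.+1) t y i * w y.+1 i -
      (y.+1%:R * long_limit R y.+1 - y%:R * long_limit R y)) =
    \sum_(y < N) \sum_(2 <= i < N.+1) (t y i - g y i) * w y.+1 i +
    \sum_(y < N) (\sum_(2 <= i < N.+1) g y i * w y.+1 i -
      (y.+1%:R * long_limit R y.+1 - y%:R * long_limit R y)).
  rewrite -big_split /=; apply: eq_bigr => y _; rewrite addrA; congr (_ - _).
  by rewrite -big_split /=; apply: eq_bigr => i _; rewrite -mulrDl subrK.
apply: le_trans (ler_normD _ _) _.
have -> : (c * f + f + d) / N%:R = (c * f + f) / N%:R + d / N%:R :> R.
  by rewrite -mulrDl.
apply: lerD; last first.
  apply: le_trans (ler_norm_sum _ _ _) _.
  apply: le_trans (_ : \sum_(y < N) d / N%:R ^+ 2 <= _).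
    apply: ler_sum => y _; apply: le_trans (multi_weight_limit R y N0) _; rewrite -dE.
    rewrite ler_wpM2l // lef_pV2 ?posrE ?exprn_gt0 //.
    by rewrite ler_weXn2l // ler1n.
  rewrite sumr_const card_ord -mulr_natr le_eqVlt; apply/orP; left; apply/eqP.
  by field; rewrite gt_eqF.
pose a y i : R := c / N%:R ^+ 2 * (y.+1%:R ^+ 2 * (w y.+1 i * i.+1%:R ^+ 3)).
pose b y i : R := i.+1%:R ^+ 2 / i`!%:R / N%:R * (N == i * y.+1)%N%:R.
apply: le_trans (_ : \sum_(y < N) \sum_(2 <= i < N.+1) (a y i + b y i) <= _).
  apply: le_trans (ler_norm_sum _ _ _) _; apply: ler_sum => y _.
  apply: le_trans (ler_norm_sum _ _ _) _; apply: ler_sum_nat => i /andP [i2 _].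
  rewrite normrM (ger0_norm (w0 _ _)).
  apply: le_trans (ler_wpM2r (w0 _ _) (multi_term R (ltn0Sn y) i2 M0 MN)) _; rewrite -cE.
  rewrite mulrDl lerD //.
    by rewrite /a le_eqVlt; apply/orP; left; apply/eqP; ring.
  rewrite /b; case: eqP => [NE|_]; last by rewrite !(mulr0, mul0r).
  rewrite !mulr1 /w.
  rewrite mulrA [X in _ <= X]mulrAC ler_wpM2r ?invr_ge0 //.
  have y0 : 0 < y.+1%:R :> R by rewrite ltr0n.
  apply: le_trans (_ : N%:R * y.+1%:R^-1 ^+ 2 <= _).
    rewrite ler_pM ?exprn_ge0 ?invr_ge0 // ?ler_nat; first by case/andP: MN.
    by rewrite -(subnKC i2) exprD ler_piMr ?exprn_ge0 ?invr_ge0 // exprn_ile1 ?invr_ge0 // invf_le1 // ler1n.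
  rewrite ler_pdivlMr // exprVn mulrAC ler_pdivrMr ?exprn_gt0 //.
  rewrite -expr2 -exprMn lerXn2r ?nnegrE ?mulr_ge0 // -natrM ler_nat.
  by rewrite [X in (X <= _)%N]NE leq_mul2r leqnSn orbT.
under eq_bigr do rewrite big_split /=.
rewrite big_split /=.
have -> : (c * f + f) / N%:R = c * f / N%:R + f / N%:R :> R.
  by rewrite -mulrDl.
apply: lerD.
  apply: le_trans (_ : \sum_(y < N) c * f / N%:R ^+ 2 <= _).
    apply: ler_sum => y _; rewrite -!mulr_sumr.
    have y0 : 0 < y.+1%:R ^+ 2 :> R by rewrite exprn_gt0 // ltr0n.
    apply: le_trans (_ : c / N%:R ^+ 2 * f <= _); last first.
      by rewrite mulrAC.
    rewrite ler_wpM2l ?divr_ge0 ?exprn_ge0 //.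
    apply: le_trans (ler_wpM2l (ltW y0) (weight_sum R N.+1 (ltn0Sn y) (ltn0Sn 1))) _; rewrite -fE.
    by rewrite mulrCA divff ?mulr1 // gt_eqF.
  rewrite sumr_const card_ord -mulr_natr le_eqVlt; apply/orP; left; apply/eqP.
  by field; rewrite gt_eqF.
rewrite exchange_big /=.
apply: le_trans (_ : \sum_(2 <= i < N.+1) f / N%:R * (i.+1%:R ^+ 2)^-1 <= _).
  apply: ler_sum_nat => i /andP [i2 _].
  apply: le_trans (@sum_indicator R N (fun y => (i * y.+1)%N) N (i.+1%:R ^+ 2 / i`!%:R / N%:R) _ _) _.
  - by rewrite !mulr_ge0 ?exprn_ge0 ?invr_ge0.
  - by move=> y y' /eqP; rewrite eqn_pmul2l ?(ltnW i2) // => /eqP [].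
  rewrite [X in _ <= X]mulrAC ler_wpM2r ?invr_ge0 //.
  have i0 : 0 < i.+1%:R :> R by rewrite ltr0n.
  have i1 : 1 <= i.+1%:R :> R by rewrite ler1n.
  apply: le_trans (ler_wpM2l _ (invfact_le R i)) _; first by rewrite exprn_ge0.
  rewrite -fE.
  rewrite (_ : _ * _ = f / i.+1%:R ^+ 2 * i.+1%:R^-1); last by field; rewrite gt_eqF.
  by rewrite ler_piMr ?divr_ge0 ?exprn_ge0 // invf_le1.
rewrite -mulr_sumr ler_piMr ?divr_ge0 //.
apply: le_trans (sum_inv_sqr R N.+1 (ltn0Sn 1)) _.
by rewrite invf_le1 // ler1n.
Qed.

(* [g] stands for [expR (- euler_gamma R)]. *)
Lemma kernel_sum (R : realType) (g C : R) :
  (forall N, (0 < N)%N -> `|N%:R * long_limit R N - g| <= C / N%:R) ->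
  exists K : R, forall N M, (0 < M)%N -> (M <= N <= M.*2)%N ->
  `|\sum_(y < M.-1) long_prop R M y.+1 / y.+1%:R -
    \sum_(y < N.-1) long_prop R (N - y.+1) y.+1 / y.+1%:R -
    (N%:R^-1 - (1 - g) / M%:R)| <= K / N%:R ^+ 2.
Proof.
move=> Hg; have [K HK] := multi_sum_main R.
exists (2 * (K + C)) => N M M0 MN; have N0 : (0 < N)%N by lia.
have M0' : 0 < M%:R :> R by rewrite ltr0n.
have N0' : 0 < N%:R :> R by rewrite ltr0n.
have NM' : N%:R <= 2 * M%:R :> R by rewrite -natrM ler_nat; lia.
have E1 : \sum_(y < M.-1) long_prop R M y.+1 / y.+1%:R =
    (M%:R - 1 - \sum_(n < M) multi_sum R N n) / M%:R.
  rewrite -(@long_prop_div_sum R N M) //; last by lia.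
  by rewrite mulrC mulKf // gt_eqF.
have E2 : \sum_(y < N.-1) long_prop R (N - y.+1) y.+1 / y.+1%:R =
    1 - multi_sum R N N - N%:R^-1.
  rewrite -(@unique_shortest R N N) // -[in RHS](prednK N0) big_ord_recr /=.
  by rewrite prednK // subnn long_prop0 mul1r addrK.
rewrite E1 E2.
set A := multi_sum R N N; set S := \sum_(n < M) _.
have -> : (M%:R - 1 - S) / M%:R - (1 - A - N%:R^-1) - (N%:R^-1 - (1 - g) / M%:R) =
   (M%:R * A - S - N%:R * long_limit R N + (N%:R * long_limit R N - g)) / M%:R.
  by field; rewrite !gt_eqF.
rewrite normrM (ger0_norm (x := M%:R^-1)) ?invr_ge0 ?ler0n //.
have H : `|M%:R * A - S - N%:R * long_limit R N + (N%:R * long_limit R N - g)| <= (K + C) / N%:R.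
  by rewrite mulrDl; apply: le_trans (ler_normD _ _) _; rewrite lerD ?HK ?Hg.
have KC0 : 0 <= K + C.
  by have := le_trans (normr_ge0 _) H; rewrite pmulr_lge0 ?invr_gt0.
apply: le_trans (ler_wpM2r _ H) _; first by rewrite invr_ge0 ler0n.
rewrite -[X in X <= _]mulrA (_ : 2 * (K + C) / N%:R ^+ 2 = (K + C) * (2 / N%:R ^+ 2)); last by ring.
rewrite ler_wpM2l // ler_pdivlMr ?exprn_gt0 //.
rewrite (_ : _ * _ = N%:R / M%:R); last by field; rewrite !gt_eqF.
by rewrite ler_pdivrMr.
Qed.

(** * Contraction of the renewal kernel *)

Definition knot h y i := ((i * y) %/ h).+1.

Lemma knot_bounds h y i : (0 < h)%N ->
  (i * y < h * knot h y i)%N /\ (h * knot h y i <= i * y + h)%N.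
Proof.
move=> h0; rewrite /knot; have := ltn_ceil (i * y) h0.
by have := leq_trunc_div (i * y) h; rewrite mulnS [(h * _)%N]mulnC; lia.
Qed.

Lemma knotS_le h y i : (0 < h)%N -> (knot h y i <= knot h y i.+1)%N.
Proof. by move=> h0; rewrite /knot ltnS leq_div2r // leq_mul2r leqnSn orbT. Qed.

Lemma knot_add h y i : (0 < h)%N -> knot h y (i + h) = (knot h y i + y)%N.
Proof. by move=> h0; rewrite /knot mulnDl addnC [(h * y)%N]mulnC divnMDl // -addnS addnC. Qed.

Lemma knot_cell h y k : (0 < h)%N -> (0 < y)%N -> (0 < k)%N ->
  (knot h y ((h * k.-1) %/ y) <= k <= knot h y ((h * k.-1) %/ y).+1)%N.
Proof.
move=> h0 y0 k0; set i := (_ %/ y)%N; have [l1 u1] := knot_bounds y i h0.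
have [l2 u2] := knot_bounds y i.+1 h0.
have := leq_trunc_div (h * k.-1) y; have := ltn_ceil (h * k.-1) y0.
rewrite -/i => I1 I2.
have : (h * knot h y i < h * k.+1)%N by nia.
have : (h * k < h * (knot h y i.+1).+1)%N by nia.
by rewrite !ltn_mul2l h0 /= !ltnS => -> ->.
Qed.

(* A lower bound on grid points propagates through the delay recurrence; the
   slack [delta] absorbs the rounding of the knots. *)
Lemma grid_lower (R : realType) h y T (delta : R) (a v : nat -> R) :
  (0 < h)%N -> (0 < y)%N -> 0 < delta -> 4 <= delta * y%:R ->
  (forall k, (y.*2 < k)%N -> k.+1%:R * v k.+1 = k%:R * v k + v (k - y)%N) ->
  (forall i k, (h <= i < h.*2)%N -> (knot h y i <= k <= knot h y i.+1)%N ->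
     Num.min (a i) (a i.+1) <= v k) ->
  a h.*2 <= v (knot h y h.*2) ->
  (forall i, (h <= i <= T)%N -> `|a i| <= 2) ->
  (forall i, (h.*2 <= i < T)%N ->
     a i.+1 <= (i%:R * a i + Num.min (a (i - h)%N) (a (i - h).+1)) / i.+1%:R - delta) ->
  forall i k, (h <= i < T)%N -> (knot h y i <= k <= knot h y i.+1)%N ->
    Num.min (a i) (a i.+1) <= v k.
Proof.
move=> h0 y0 d0 dy rec base pt amax step.
have main i : (h <= i < T)%N ->
   (forall k, (knot h y i <= k <= knot h y i.+1)%N -> Num.min (a i) (a i.+1) <= v k) /\
   ((h.*2 <= i.+1)%N -> a i.+1 <= v (knot h y i.+1)).
  elim/ltn_ind: i => i IH /andP [hi iT].
  have [i2h|h2i] := ltnP i h.*2.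
    split=> [k kc|hi']; first by apply: base => //; rewrite hi.
    by have -> : i.+1 = h.*2 by lia.
  have ai : a i <= v (knot h y i).
    move: h2i; rewrite leq_eqVlt => /orP [/eqP <- //|h2i].
    case: i IH hi iT h2i => // i IH hi iT h2i.
    by have [_ H] := IH i (ltnSn i) ltac:(lia); apply: H; lia.
  set lo := Num.min (a (i - h)%N) (a (i - h).+1).
  have cell j : (knot h y i <= j < knot h y i.+1)%N -> lo <= v (j - y)%N.
    move=> /andP [j1 j2]; have [+ _] := IH (i - h)%N ltac:(lia) ltac:(lia); apply.
    have := knot_add y (i - h) h0; have := knot_add y (i - h).+1 h0.
    by rewrite addSn subnK //; lia.
  set K := knot h y i in ai cell *; set K' := knot h y i.+1 in cell *.
  have [lK uK] := knot_bounds y i h0; have [lK' uK'] := knot_bounds y i.+1 h0.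
  rewrite -/K in lK uK; rewrite -/K' in lK' uK'.
  have yK : (y.*2 < K)%N.
    rewrite -(ltn_pmul2l h0); apply: leq_ltn_trans lK.
    apply: leq_trans (_ : h.*2 * y <= _)%N; first by rewrite -!muln2; apply: eq_leq; ring.
    by rewrite leq_mul2r h2i orbT.
  have grow d : (K + d <= K')%N ->
      K%:R * a i + d%:R * lo <= (K + d)%:R * v (K + d)%N.
    elim: d => [|d IHd] dK; first by rewrite addn0 mul0r addr0 ler_wpM2l.
    rewrite addnS rec; last by lia.
    rewrite -natr1 mulrDl mul1r addrA lerD //; first by apply: IHd; lia.
    by apply: cell; lia.
  have KK' : (K <= K')%N by exact: knotS_le.
  have yKn' : (y <= K')%N by apply: leq_trans KK'; apply: leq_trans (ltnW yK); rewrite -addnn leq_addr.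
  have K0 : 0 < K%:R :> R by rewrite ltr0n; lia.
  have end_pt : K'%:R * a i.+1 <= K%:R * a i + (K' - K)%:R * lo.
    have iT' : (h <= i <= T)%N by lia.
    have aib := amax i iT'.
    have lob : `|lo| <= 2.
      by rewrite /lo /Num.min; case: ifP => _; apply: amax; lia.
    have := step i; rewrite -/lo => /(_ ltac:(lia)) st.
    have i0 : 0 < i.+1%:R :> R by rewrite ltr0n.
    rewrite natrB //.
    have hR : 0 < h%:R :> R by rewrite ltr0n.
    pose e1 : R := K%:R - i%:R * y%:R / h%:R.
    pose e2 : R := K'%:R - i.+1%:R * y%:R / h%:R.
    have E1 : 0 <= e1 <= 1.
      rewrite /e1 subr_ge0 lerBlDr ler_pdivrMr // -natrM -natrM ler_nat.
      rewrite [(K * h)%N]mulnC (ltnW lK) /=.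
      rewrite -(ler_pM2l hR) mulrDr mulr1 mulrCA divff ?gt_eqF // mulr1.
      by rewrite -!natrM -natrD ler_nat addnC.
    have E2 : 0 <= e2 <= 1.
      rewrite /e2 subr_ge0 lerBlDr ler_pdivrMr // -natrM -natrM ler_nat.
      rewrite [(K' * h)%N]mulnC (ltnW lK') /=.
      rewrite -(ler_pM2l hR) mulrDr mulr1 mulrCA divff ?gt_eqF // mulr1.
      by rewrite -!natrM -natrD ler_nat addnC.
    have yK' : y%:R <= K'%:R :> R by rewrite ler_nat.
    have dK : 4 <= delta * K'%:R by apply: le_trans dy _; rewrite ler_wpM2l // ltW.
    apply: le_trans (ler_wpM2l (ler0n _ _) st) _.
    rewrite -subr_ge0.
    have -> : K%:R * a i + (K'%:R - K%:R) * lo -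
       K'%:R * ((i%:R * a i + lo) / i.+1%:R - delta) =
       (a i - lo) * (e1 - e2 * (i%:R / i.+1%:R)) + delta * K'%:R.
      rewrite /e1 /e2 -!(natr1 i); field.
      by rewrite natr1 !gt_eqF.
    have w01 : 0 <= (i%:R / i.+1%:R : R) <= 1.
      by rewrite divr_ge0 //= ler_pdivrMr // mul1r ler_nat leqnSn.
    have err : `|e1 - e2 * (i%:R / i.+1%:R)| <= 1.
      move: w01 E1 E2; move: (i%:R / _) => w /andP [? ?] /andP [? ?] /andP [? ?].
      have p0 : 0 <= e2 * w by rewrite mulr_ge0.
      have p1 : e2 * w <= 1 by rewrite mulr_ile1.
      by rewrite ler_norml; apply/andP; split; lra.
    have dif : `|a i - lo| <= 4.
      by apply: le_trans (ler_normB _ _) _; lra.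
    have : `|(a i - lo) * (e1 - e2 * (i%:R / i.+1%:R))| <= 4.
      by rewrite normrM -[X in _ <= X]mulr1 ler_pM.
    by rewrite ler_norml => /andP [Xge _]; have := lerD Xge dK; rewrite addNr.
  have fin k : (K <= k <= K')%N -> Num.min (a i) (a i.+1) <= v k.
    move=> /andP [Kk kK']; have := grow (k - K)%N; rewrite subnKC // => /(_ kK') g.
    have k0 : 0 < k%:R :> R by rewrite ltr0n; lia.
    rewrite -(ler_pM2l k0); apply: le_trans g; set m := Num.min _ _.
    have ma : m <= a i by rewrite /m ge_min lexx.
    have ma' : m <= a i.+1 by rewrite /m ge_min lexx orbT.
    rewrite natrB // in end_pt; rewrite natrB //.
    have Kk' : K%:R <= k%:R :> R by rewrite ler_nat.
    have kK'' : k%:R <= K'%:R :> R by rewrite ler_nat.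
    have [lm|ml] := leP m lo.
      have -> : k%:R * m = K%:R * m + (k%:R - K%:R) * m by ring.
      by apply: lerD; apply: ler_wpM2l; rewrite ?subr_ge0.
    have p1 : 0 <= (K'%:R - k%:R) * (m - lo) by rewrite mulr_ge0 ?subr_ge0 // ltW.
    have p2 : K'%:R * m <= K'%:R * a i.+1 by rewrite ler_wpM2l.
    rewrite -subr_ge0 (_ : _ - _ = (K%:R * a i + (K'%:R - K%:R) * lo - K'%:R * a i.+1) +
      (K'%:R * a i.+1 - K'%:R * m) + (K'%:R - k%:R) * (m - lo)); last by ring.
    by apply: addr_ge0 => //; apply: addr_ge0; rewrite subr_ge0.
  split=> [k kc|_]; first exact: fin.
  have K0' : 0 < K'%:R :> R by rewrite ltr0n; lia.
  rewrite -(ler_pM2l K0'); have := grow (K' - K)%N; rewrite subnKC // => /(_ (leqnn _)).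
  exact: le_trans.
by move=> i k hi; have [H _] := main i hi; exact: H.
Qed.

Lemma grid_long_prop (R : realType) h y T (delta : R) (a b : nat -> R) :
  (0 < h)%N -> (0 < y)%N -> 0 < delta -> 4 <= delta * y%:R ->
  (forall i, (h <= i <= h.*2)%N -> a i <= h%:R / i%:R - delta /\ h%:R / i%:R <= b i) ->
  (forall i, (h <= i <= T)%N -> `|a i| <= 2 /\ `|b i| <= 2) ->
  (forall i, (h.*2 <= i < T)%N ->
     a i.+1 <= (i%:R * a i + Num.min (a (i - h)%N) (a (i - h).+1)) / i.+1%:R - delta /\
     (i%:R * b i + Num.max (b (i - h)%N) (b (i - h).+1)) / i.+1%:R + delta <= b i.+1) ->
  forall i k, (h <= i < T)%N -> (knot h y i <= k <= knot h y i.+1)%N ->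
    Num.min (a i) (a i.+1) <= y%:R * long_prop R k y <= Num.max (b i) (b i.+1).
Proof.
move=> h0 y0 d0 dy init amax step.
have h0' : 0 < h%:R :> R by rewrite ltr0n.
have y0' : 0 < y%:R :> R by rewrite ltr0n.
have rec k : (y.*2 < k)%N -> k.+1%:R * (y%:R * long_prop R k.+1 y) =
    k%:R * (y%:R * long_prop R k y) + y%:R * long_prop R (k - y) y.
  move=> yk; have := long_propS R k y; rewrite (_ : (y <= k)%N = true); last by lia.
  by move=> E; rewrite mulrCA E mulrDr mulrCA.
have first_cells i k : (h <= i < h.*2)%N -> (knot h y i <= k <= knot h y i.+1)%N ->
    y%:R * long_prop R k y = y%:R / k%:R /\ (y < k)%N.
  move=> /andP [hi ih] /andP [k1 k2].
  have [l1 _] := knot_bounds y i h0; have [_ u2] := knot_bounds y i.+1 h0.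
  have yk : (y < k)%N.
    apply: leq_trans k1; rewrite -(ltn_pmul2l h0); apply: leq_ltn_trans l1.
    by rewrite leq_mul2r hi orbT.
  have k2y : (k <= y.*2.+1)%N.
    apply: leq_trans k2 _; rewrite -(leq_pmul2l h0); apply: leq_trans u2 _.
    rewrite mulnS addnC leq_add2l; apply: leq_trans (_ : h.*2 * y <= _)%N.
      by rewrite leq_mul2r ih orbT.
    by rewrite -!muln2; apply: eq_leq; ring.
  by rewrite long_prop_single.
have low_pt i k : (h <= i <= h.*2)%N -> (y < k)%N -> (k <= knot h y i)%N ->
    a i <= y%:R / k%:R.
  move=> ih yk ki; have [ai _] := init i ih; apply: le_trans ai _.
  have [_ u] := knot_bounds y i h0.
  have k0 : 0 < k%:R :> R by rewrite ltr0n; lia.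
  have i0 : 0 < i%:R :> R by rewrite ltr0n; lia.
  rewrite ler_pdivlMr // mulrBl.
  have hk : h%:R * k%:R <= i%:R * y%:R + h%:R :> R.
    by rewrite -!natrM -natrD ler_nat; apply: leq_trans u; rewrite leq_mul2l ki orbT.
  have hi : h%:R <= i%:R :> R by rewrite ler_nat; case/andP: ih.
  have E : h%:R / i%:R * k%:R <= y%:R + 1 :> R.
    rewrite mulrAC ler_pdivrMr // mulrDl mul1r; apply: le_trans hk _.
    by rewrite [y%:R * _]mulrC lerD2l.
  have dk : 4 <= delta * k%:R.
    by apply: le_trans dy _; rewrite ler_wpM2l ?(ltW d0) // ler_nat ltnW.
  by rewrite lerBlDr; apply: le_trans E _; rewrite lerD2l; apply: le_trans dk; rewrite ler1n.
have high_pt i k : (h <= i <= h.*2)%N -> (knot h y i <= k)%N -> y%:R / k%:R <= b i.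
  move=> ih ki; have [_ bi] := init i ih; apply: le_trans bi.
  have [l _] := knot_bounds y i h0.
  rewrite ler_pdivrMr; last by rewrite ltr0n; apply: leq_trans ki.
  rewrite mulrAC ler_pdivlMr ?ltr0n; last by lia.
  by rewrite -!natrM ler_nat mulnC; apply: leq_trans (ltnW l) _; rewrite leq_mul2l ki orbT.
have end_knot : knot h y h.*2 = y.*2.+1.
  by rewrite /knot -muln2 -mulnA mulKn // mul2n.
move=> i k iT kc; apply/andP; split.
  apply: (@grid_lower R h y T delta a (fun k => y%:R * long_prop R k y)) => //.
  - move=> j l jh lc; have [-> yl] := first_cells j l jh lc.
    rewrite ge_min; apply/orP; right; apply: low_pt => //; first by lia.
    by case/andP: lc.
  - have hh : (h <= h.*2 <= h.*2)%N by lia.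
    rewrite end_knot long_prop_single ?leqnn //; last by lia.
    by apply: low_pt => //; rewrite ?end_knot //; lia.
  - by move=> j /amax [].
  - by move=> j /step [].
rewrite -lerN2 oppr_max.
apply: (@grid_lower R h y T delta (fun i => - b i) (fun k => - (y%:R * long_prop R k y))) => //.
- by move=> l /rec E; rewrite !mulrN E opprD.
- move=> j l jh lc; have [-> yl] := first_cells j l jh lc.
  rewrite -oppr_max lerN2 le_max; apply/orP; left; apply: high_pt; first by lia.
  by case/andP: lc.
- have hh : (h <= h.*2 <= h.*2)%N by lia.
  rewrite lerN2 end_knot long_prop_single ?leqnn //; last by lia.
  by apply: high_pt => //; rewrite end_knot.
- by move=> j /amax [_]; rewrite normrN.
move=> j /step [_ H]; rewrite -oppr_max mulrN -opprD mulNr -opprD lerN2.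
exact: H.
Qed.

Lemma long_prop_osc_tail (R : realType) y (V : R) : (0 < y)%N ->
  (forall k k', (3 * y < k)%N -> (3 * y < k')%N ->
     y%:R * `|long_prop R k y - long_prop R k' y| <= V) ->
  forall j k k', (2 < j)%N -> (j * y < k)%N -> (j * y < k')%N ->
     y%:R * `|long_prop R k y - long_prop R k' y| <= V * 6 / j`!%:R.
Proof.
move=> y0 H; have y0' : 0 < y%:R :> R by rewrite ltr0n.
elim=> // j IH k k'; rewrite ltnS leq_eqVlt => /orP [/eqP <- kj kj'|j2 kj kj'].
  by rewrite (_ : 3`! = 6)%N // mulfK ?pnatr_eq0 //; exact: H.
have := @long_prop_osc_step R (j * y).+1 y (V * 6 / j`!%:R / y%:R) _ k k'.
rewrite (_ : (j * y).+1 + y = (j.+1 * y).+1)%N; last by rewrite mulSn; lia.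
have V0 : 0 <= V.
  by have := H _ _ (ltnSn (3 * y)) (ltnSn (3 * y)); rewrite subrr normr0 mulr0.
have f0 : 0 < j`!%:R :> R by rewrite ltr0n fact_gt0.
have j0 : 0 < j.+1%:R :> R by rewrite ltr0n.
have q0 : 0 < (j.+1 * y).+2%:R :> R by rewrite ltr0n.
move=> /(_ _ kj kj') H1; rewrite -ler_pdivlMl //; apply: le_trans (H1 _) _.
  by move=> l l' ll ll'; rewrite ler_pdivlMr // mulrC; exact: IH.
rewrite divfK ?gt_eqF //.
have -> : y%:R^-1 * (V * 6 / j.+1`!%:R) = V * 6 / j`!%:R * (j.+1%:R * y%:R)^-1.
  by rewrite factS natrM; field; rewrite !gt_eqF.
rewrite ler_wpM2l ?divr_ge0 ?mulr_ge0 ?ler0n ?(ltW f0) // lef_pV2 ?posrE ?mulr_gt0 //.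
by rewrite -natrM ler_nat ltnW.
Qed.

Lemma sum_between m u v : (\sum_(y < m) (u <= y < v) <= v - u)%N.
Proof.
apply: leq_trans (_ : minn m v - u <= _)%N; last by lia.
elim: m => [|m IH]; first by rewrite big_ord0.
rewrite big_ord_recr /=; apply: leq_trans (leq_add IH (leqnn _)) _.
by case: (boolP (u <= m < v)%N) => /= c; lia.
Qed.

Lemma quotient_count (R : realType) A m k : (0 < k)%N ->
  \sum_(y < m) ((A %/ y.+1)%N == k)%:R <= A%:R / (k%:R * k.+1%:R) + 1 :> R.
Proof.
move=> k0; have k0' : 0 < k%:R :> R by rewrite ltr0n.
have k1' : 0 < k.+1%:R :> R by rewrite ltr0n.
rewrite -natr_sum.
have E : (\sum_(y < m) ((A %/ y.+1)%N == k) = \sum_(y < m) (A %/ k.+1 <= y < A %/ k))%N.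
  apply: eq_bigr => y _; congr nat_of_bool.
  rewrite eqn_leq -[(_ %/ _ <= k)%N]ltnS -[(_ %/ _ <= y)%N]ltnS !ltn_divLR //.
  by rewrite !leq_divRL // [(k.+1 * _)%N]mulnC [(k * _)%N]mulnC.
have := sum_between m (A %/ k.+1) (A %/ k); rewrite -E => cnt.
apply: le_trans (_ : ((A %/ k)%N - (A %/ k.+1)%N)%:R <= _); first by rewrite ler_nat.
have le1 : (A %/ k)%:R <= A%:R / k%:R :> R.
  by rewrite ler_pdivlMr // -natrM ler_nat leq_trunc_div.
have le2 : A%:R / k.+1%:R - 1 <= (A %/ k.+1)%:R :> R.
  rewrite lerBlDr ler_pdivrMr // natr1 -natrM ler_nat ltnW //.
  by apply: ltn_ceil.
have -> : A%:R / (k%:R * k.+1%:R) + 1 = A%:R / k%:R - (A%:R / k.+1%:R - 1) :> R.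
  by rewrite -natr1; field; rewrite natr1 !gt_eqF.
have [le|lt] := leqP (A %/ k.+1) (A %/ k); first by rewrite natrB // lerB.
rewrite (_ : (_ - _)%N = 0%N); last by lia.
rewrite subr_ge0 lerBlDr; apply: le_trans (_ : A%:R / k%:R <= _); last by rewrite lerDl.
by rewrite ler_wpM2l ?ler0n // lef_pV2 ?posrE // ler_nat.
Qed.

(* The sum over [y] is grouped by [k = (h * m) %/ y]. *)
Lemma block_sum (R : realType) h B m (c : R) (D f : nat -> R) :
  (0 < h)%N -> (0 < B)%N -> (0 < m)%N -> 0 <= c -> (forall k, 0 <= D k) ->
  (forall y, (0 < y <= m)%N -> ((h * m) %/ y < B * h)%N ->
     y%:R * f y <= D ((h * m) %/ y)%N) ->
  (forall y, (0 < y <= m)%N -> (B * y <= m)%N -> f y <= c * y%:R ^+ 4 / m%:R ^+ 5) ->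
  \sum_(y < m) f y.+1 / y.+1%:R ^+ 2 <=
    (\sum_(h <= k < B * h) D k * k.+1%:R ^+ 2 / k%:R) / (h%:R * m%:R) ^+ 2 +
    (\sum_(h <= k < B * h) D k * k.+1%:R ^+ 3) / (h%:R * m%:R) ^+ 3 +
    c / B%:R ^+ 3 / m%:R ^+ 2.
Proof.
move=> h0 B0 m0 c0 D0 near far.
have h0' : 0 < h%:R :> R by rewrite ltr0n.
have m0' : 0 < m%:R :> R by rewrite ltr0n.
have B0' : 0 < B%:R :> R by rewrite ltr0n.
have hm0 : 0 < h%:R * m%:R :> R by rewrite mulr_gt0.
pose w k : R := D k * (k.+1%:R / (h%:R * m%:R)) ^+ 3.
have w0 k : 0 <= w k by rewrite mulr_ge0 ?exprn_ge0 ?divr_ge0 // ltW.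
have t0 : 0 <= c / B%:R ^+ 2 / m%:R ^+ 3.
  by rewrite !divr_ge0 ?exprn_ge0 ?ler0n.
apply: le_trans (_ : \sum_(y < m) (\sum_(h <= k < B * h) w k * (((h * m) %/ y.+1)%N == k)%:R +
    c / B%:R ^+ 2 / m%:R ^+ 3 * (0 <= y < m %/ B)%N%:R) <= _).
  apply: ler_sum => y _.
  have y0 : 0 < y.+1%:R :> R by rewrite ltr0n.
  have ym : (0 < y.+1 <= m)%N by rewrite ltn_ord.
  have wsum : 0 <= \sum_(h <= k < B * h) w k * (((h * m) %/ y.+1)%N == k)%:R.
    by apply: sumr_ge0 => k _; rewrite mulr_ge0.
  have [kB|Bk] := ltnP ((h * m) %/ y.+1) (B * h).
    apply: le_trans (_ : w ((h * m) %/ y.+1)%N <= _).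
      rewrite ler_pdivrMr ?exprn_gt0 // -(ler_pM2l y0).
      apply: le_trans (near _ ym kB) _; rewrite /w; set k := (_ %/ _)%N.
      rewrite [X in _ <= X](_ : _ = D k * (y.+1%:R * (k.+1%:R / (h%:R * m%:R))) ^+ 3); last first.
        by move: (D k) (k.+1%:R / _) (y.+1%:R) => d X Y; ring.
      rewrite ler_peMr // exprn_ege1 // mulrA ler_pdivlMr // mul1r -!natrM ler_nat.
      by rewrite [(y.+1 * _)%N]mulnC ltnW //; exact: ltn_ceil.
    rewrite -[X in X <= _]addr0 lerD //; last by rewrite mulr_ge0.
    set k := (_ %/ _)%N; rewrite (bigD1_seq k) ?iota_uniq //=; last first.
      rewrite mem_index_iota kB andbT /k leq_divRL // leq_mul2l.
      by rewrite (ltn_ord y) orbT.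
    by rewrite eqxx mulr1 lerDl sumr_ge0 // => j _; rewrite mulr_ge0.
  have By : (B * y.+1 <= m)%N.
    by rewrite leq_divRL // in Bk; rewrite -(leq_pmul2l h0) mulnA [(h * B)%N]mulnC.
  rewrite -[X in X <= _]add0r lerD //.
  rewrite (_ : (0 <= y < m %/ B)%N = true) ?mulr1; last first.
    by rewrite /= leq_divRL // mulnC.
  rewrite ler_pdivrMr ?exprn_gt0 //; apply: le_trans (far _ ym By) _.
  rewrite [X in _ <= X](_ : _ = c * y.+1%:R ^+ 2 / m%:R ^+ 5 * (m%:R / B%:R) ^+ 2); last first.
    by field; rewrite !gt_eqF.
  rewrite (_ : c * y.+1%:R ^+ 4 / m%:R ^+ 5 = c * y.+1%:R ^+ 2 / m%:R ^+ 5 * y.+1%:R ^+ 2); last by ring.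
  rewrite ler_wpM2l ?divr_ge0 ?mulr_ge0 ?exprn_ge0 ?ler0n //.
  rewrite lerXn2r ?nnegrE ?divr_ge0 ?(ltW y0) ?(ltW m0') ?(ltW B0') //.
  by rewrite ler_pdivlMr // -natrM ler_nat mulnC.
rewrite big_split /= lerD //; last first.
  rewrite -mulr_sumr -natr_sum.
  apply: le_trans (_ : c / B%:R ^+ 2 / m%:R ^+ 3 * (m%:R / B%:R) <= _).
    rewrite ler_wpM2l //; apply: le_trans (_ : (m %/ B)%:R <= _).
      by rewrite ler_nat; have := sum_between m 0 (m %/ B); rewrite subn0.
    by rewrite ler_pdivlMr // -natrM ler_nat leq_trunc_div.
  by rewrite le_eqVlt; apply/orP; left; apply/eqP; field; rewrite !gt_eqF.
rewrite exchange_big /= !mulr_suml -big_split /=.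
apply: ler_sum_nat => k /andP [hk _]; rewrite -mulr_sumr.
have k0 : (0 < k)%N by lia.
have k0' : 0 < k%:R :> R by rewrite ltr0n.
apply: le_trans (ler_wpM2l (w0 k) (quotient_count R (h * m) m k0)) _.
have k1 : k.+1%:R != 0 :> R by rewrite pnatr_eq0.
rewrite le_eqVlt; apply/orP; left; apply/eqP; rewrite /w natrM.
by move: k1; move: (k.+1%:R) => K K0; field; rewrite K0 !gt_eqF.
Qed.

(* [grid_lo_at i] and [grid_hi_at i], divided by [grid_scale], enclose
   [y * long_prop R k y] at [k = knot 64 y i], and [grid_diff k] bounds its oscillation
   between [m + 1] and [N - y], which is about [2 * m - y], when [k = (64 * m) %/ y]. *)
Definition grid_scale : N := 100000000.

Fixpoint grid_lo (n : nat) : seq N :=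
  if n is n'.+1 then
    let l := grid_lo n' in let i := N.of_nat (128 + n') in
    ((i * nth 0 l 0 + N.min (nth 0 l 64) (nth 0 l 63)) / (i + 1) - 1)%num :: l
  else rev [seq (grid_scale * 64 / N.of_nat i - 1)%num | i <- iota 64 65].

Fixpoint grid_hi (n : nat) : seq N :=
  if n is n'.+1 then
    let l := grid_hi n' in let i := N.of_nat (128 + n') in
    ((i * nth 0 l 0 + N.max (nth 0 l 64) (nth 0 l 63)) / (i + 1) + 2)%num :: l
  else rev [seq (grid_scale * 64 / N.of_nat i + 1)%num | i <- iota 64 65].

Definition grid_lo_at := let l := rev (grid_lo 196) in fun i => nth 0%num l (i - 64).
Definition grid_hi_at := let l := rev (grid_hi 196) in fun i => nth 0%num l (i - 64).

Fixpoint fact_bin (n : nat) : N :=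
  if n is n'.+1 then (N.of_nat n * fact_bin n')%num else 1%num.

Lemma fact_binE n : N.to_nat (fact_bin n) = n`!.
Proof.
elim: n => // n IH; rewrite factS -IH.
by rewrite -[LHS]/(N.to_nat (N.of_nat n.+1 * fact_bin n)%num) N2Nat.inj_mul Nat2N.id.
Qed.

Definition grid_spread (s : seq nat) : N :=
  (foldr (fun i m => N.max (grid_hi_at i) m) 0%num s -
   foldr (fun i m => N.min (grid_lo_at i) m) grid_scale s)%num.

Definition grid_tail : N := grid_spread (iota 192 66).

Definition grid_diff (k : nat) : N :=
  if (k < 192)%N then grid_spread [:: k, k.+1 & iota (2 * k - 64) 4]
  else (6 * grid_tail / fact_bin (k %/ 64) + 1)%num.

Definition grid_weight (k : nat) : N :=
  (grid_diff k * N.of_nat k.+1 ^ 2 / N.of_nat k + 1)%num.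

Lemma grid_spreadP s i j : i \in s -> j \in s ->
  (N.to_nat (grid_hi_at i) <= N.to_nat (grid_spread s) + N.to_nat (grid_lo_at j))%N.
Proof.
move=> si sj; rewrite /grid_spread.
have : (grid_hi_at i <= foldr (fun i m => N.max (grid_hi_at i) m) 0 s)%num.
  elim: s si {sj} => // k s IH; rewrite inE /= => /orP [/eqP ->|/IH]; lia.
have : (foldr (fun i m => N.min (grid_lo_at i) m) grid_scale s <= grid_lo_at j)%num.
  elim: s sj {si} => // k s IH; rewrite inE /= => /orP [/eqP ->|/IH]; lia.
lia.
Qed.

Lemma grid_certificate : exists (S V : nat) (A B D E : nat -> nat),
  [/\ (0 < S)%N,
      forall i, (64 <= i <= 128)%N -> ((A i).+1 * i <= S * 64 <= B i * i)%N,
      forall i, (64 <= i <= 324)%N -> (A i <= 2 * S)%N /\ (B i <= 2 * S)%N,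
      forall i, (128 <= i < 324)%N ->
        ((A i.+1).+1 * i.+1 <= i * A i + minn (A (i - 64)) (A (i - 64).+1))%N /\
        (i * B i + maxn (B (i - 64)) (B (i - 64).+1) + i.+1 <= B i.+1 * i.+1)%N &
  [/\ forall i j, (192 <= i <= 257)%N -> (192 <= j <= 257)%N -> (B i <= V + A j)%N,
      forall k i j, (64 <= k < 192)%N ->
        i \in [:: k, k.+1 & iota (2 * k - 64) 4] ->
        j \in [:: k, k.+1 & iota (2 * k - 64) 4] -> (B i <= D k + A j)%N,
      forall k, (192 <= k)%N -> (6 * V <= D k * (k %/ 64)`!)%N,
      forall k, (0 < k)%N -> (D k * k.+1 ^ 2 <= E k * k)%N &
      (100 * \sum_(64 <= k < 1920) E k <= 21 * (S * 64 ^ 2))%N]].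
Proof.
exists (N.to_nat grid_scale), (N.to_nat grid_tail).
exists (fun i => N.to_nat (grid_lo_at i)), (fun i => N.to_nat (grid_hi_at i)).
exists (fun k => N.to_nat (grid_diff k)), (fun k => N.to_nat (grid_weight k)).
split; [by rewrite /grid_scale; lia | move=> i hi | move=> i hi | move=> i hi | split].
- have : all (fun i => ((grid_lo_at i + 1) * N.of_nat i <=? grid_scale * 64) &&
      (grid_scale * 64 <=? grid_hi_at i * N.of_nat i))%num (iota 64 65) by vm_compute.
  move=> /allP /(_ i); rewrite mem_iota => /(_ ltac:(lia)) /andP [].
  by move=> /N.leb_spec0 h1 /N.leb_spec0 h2; apply/andP; lia.
- have : all (fun i => (grid_lo_at i <=? 2 * grid_scale) &&
      (grid_hi_at i <=? 2 * grid_scale))%num (iota 64 261) by vm_compute.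
  move=> /allP /(_ i); rewrite mem_iota => /(_ ltac:(lia)) /andP [].
  by move=> /N.leb_spec0 h1 /N.leb_spec0 h2; lia.
- have : all (fun i => ((grid_lo_at i.+1 + 1) * N.of_nat i.+1 <=?
        N.of_nat i * grid_lo_at i + N.min (grid_lo_at (i - 64)) (grid_lo_at (i - 64).+1)) &&
      (N.of_nat i * grid_hi_at i + N.max (grid_hi_at (i - 64)) (grid_hi_at (i - 64).+1)
         + N.of_nat i.+1 <=? grid_hi_at i.+1 * N.of_nat i.+1))%num (iota 128 196) by vm_compute.
  move=> /allP /(_ i); rewrite mem_iota => /(_ ltac:(lia)) /andP [].
  by move=> /N.leb_spec0 h1 /N.leb_spec0 h2; lia.
- by move=> i j hi hj; apply: grid_spreadP; rewrite mem_iota; lia.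
- move=> k i j /andP [_ k3] ik jk; rewrite /grid_diff k3.
  exact: grid_spreadP.
- move=> k k3; rewrite -fact_binE.
  have -> : grid_diff k = (6 * grid_tail / fact_bin (k %/ 64) + 1)%num.
    by rewrite /grid_diff ltnNge k3.
  have f0 : fact_bin (k %/ 64) <> 0%num.
    by have := fact_gt0 (k %/ 64); rewrite -fact_binE; lia.
  have := N.mul_succ_div_gt (6 * grid_tail) _ f0.
  have -> : (6 * N.to_nat grid_tail = N.to_nat (6 * grid_tail))%N by lia.
  move: (6 * grid_tail)%num (fact_bin _) {f0} => x f.
  move: (x / f)%num => q H; nia.
- move=> k k0; rewrite /grid_weight.
  have k0' : N.of_nat k <> 0%num by lia.
  have := N.mul_succ_div_gt (grid_diff k * N.of_nat k.+1 ^ 2) _ k0'.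
  have -> : (N.of_nat k.+1 ^ 2 = N.of_nat k.+1 * N.of_nat k.+1)%num by rewrite N.pow_2_r.
  have -> : (k.+1 ^ 2 = k.+1 * k.+1)%N by rewrite -mulnn.
  move: (grid_diff k) => d; move: (_ / _)%num => q H.
  nia.
have sumE l : (\sum_(k <- l) N.to_nat (grid_weight k) =
    N.to_nat (foldr (fun k s => (grid_weight k + s)%num) 0%num l))%N.
  elim: l => [|k l IH]; first by rewrite big_nil.
  by rewrite big_cons IH /= N2Nat.inj_add.
rewrite sumE.
have : (100 * foldr (fun k s => grid_weight k + s) 0 (index_iota 64 1920) <=?
   21 * (grid_scale * 64 ^ 2))%num by vm_compute.
move=> /N.leb_spec0; have -> : (64 ^ 2 = 64 * 64)%N by [].
by have -> : (64 ^ 2 = 64 * 64)%num by []; lia.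
Qed.

Lemma grid_cells (R : realType) (S T : nat) (A B : nat -> nat) h y :
  (0 < S)%N -> (0 < h)%N -> (4 * S <= y)%N ->
  (forall i, (h <= i <= h.*2)%N -> ((A i).+1 * i <= S * h <= B i * i)%N) ->
  (forall i, (h <= i <= T)%N -> (A i <= 2 * S)%N /\ (B i <= 2 * S)%N) ->
  (forall i, (h.*2 <= i < T)%N ->
    ((A i.+1).+1 * i.+1 <= i * A i + minn (A (i - h)) (A (i - h).+1))%N /\
    (i * B i + maxn (B (i - h)) (B (i - h).+1) + i.+1 <= B i.+1 * i.+1)%N) ->
  forall i k, (h <= i < T)%N -> (knot h y i <= k <= knot h y i.+1)%N ->
    (minn (A i) (A i.+1))%:R <= S%:R * (y%:R * long_prop R k y) <=
    (maxn (B i) (B i.+1))%:R.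
Proof.
move=> S0 h0 Sy init amax step i k iT ik.
have S0' : 0 < S%:R :> R by rewrite ltr0n.
have minE m n : (minn m n)%:R / S%:R = Num.min (m%:R / S%:R) (n%:R / S%:R) :> R.
  by rewrite /minn /Order.min ltr_pM2r ?invr_gt0 // ltr_nat; case: ifP.
have maxE m n : (maxn m n)%:R / S%:R = Num.max (m%:R / S%:R) (n%:R / S%:R) :> R.
  by rewrite /maxn /Order.max ltr_pM2r ?invr_gt0 // ltr_nat; case: ifP.
have := @grid_long_prop R h y T S%:R^-1 (fun i => (A i)%:R / S%:R) (fun i => (B i)%:R / S%:R).
move=> /(_ h0 ltac:(lia)).
rewrite invr_gt0 => /(_ S0'); rewrite mulrC ler_pdivlMr // -natrM ler_nat => /(_ Sy).
move=> H; have {H} := H _ _ _ i k iT ik; rewrite -minE -maxE.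
rewrite ler_pdivrMr // ler_pdivlMr // [_ * S%:R]mulrC; apply.
- move=> j hj; have j0 : 0 < j%:R :> R by rewrite ltr0n; lia.
  have /andP [h1 h2] := init j hj; split.
    rewrite lerBrDr -[X in _ + X]mul1r -mulrDl natr1 ler_pdivrMr // mulrAC ler_pdivlMr //.
    by rewrite -!natrM ler_nat [(h * S)%N]mulnC.
  by rewrite ler_pdivrMr // mulrAC ler_pdivlMr // -!natrM ler_nat mulnC.
- move=> j hj; have [h1 h2] := amax j hj.
  by split; rewrite ger0_norm ?divr_ge0 // ler_pdivrMr // -natrM ler_nat.
move=> j hj; have j0 : 0 < j.+1%:R :> R by rewrite ltr0n.
have [h1 h2] := step j hj; rewrite -minE -maxE; split.
  rewrite lerBrDr -[X in _ + X <= _]mul1r -mulrDl natr1 mulrA -mulrDl.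
  rewrite [X in _ <= X]mulrAC ler_wpM2r ?invr_ge0 // ler_pdivlMr //.
  by rewrite -!natrM -natrD ler_nat.
rewrite mulrA -mulrDl [X in X + _]mulrAC -[X in _ + X <= _]mul1r -mulrDl.
rewrite ler_wpM2r ?invr_ge0 // -lerBrDr ler_pdivrMr // mulrBl mul1r lerBrDr.
by rewrite -!natrM -!natrD ler_nat.
Qed.

Lemma kernel_near (R : realType) (S V : nat) (A B D : nat -> nat) N m y :
  (0 < S)%N ->
  (forall i, (64 <= i <= 128)%N -> ((A i).+1 * i <= S * 64 <= B i * i)%N) ->
  (forall i, (64 <= i <= 324)%N -> (A i <= 2 * S)%N /\ (B i <= 2 * S)%N) ->
  (forall i, (128 <= i < 324)%N ->
    ((A i.+1).+1 * i.+1 <= i * A i + minn (A (i - 64)) (A (i - 64).+1))%N /\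
    (i * B i + maxn (B (i - 64)) (B (i - 64).+1) + i.+1 <= B i.+1 * i.+1)%N) ->
  (forall i j, (192 <= i <= 257)%N -> (192 <= j <= 257)%N -> (B i <= V + A j)%N) ->
  (forall k i j, (64 <= k < 192)%N -> i \in [:: k, k.+1 & iota (2 * k - 64) 4] ->
    j \in [:: k, k.+1 & iota (2 * k - 64) 4] -> (B i <= D k + A j)%N) ->
  (forall k, (192 <= k)%N -> (6 * V <= D k * (k %/ 64)`!)%N) ->
  (120 * S <= m)%N -> (2000 <= m)%N ->
  (2 * m + 1 <= N <= 2 * m + 2)%N -> (0 < y <= m)%N ->
  ((64 * m) %/ y < 1920)%N ->
  y%:R * `|long_prop R m.+1 y - long_prop R (N - y) y| <=
    (D ((64 * m) %/ y)%N)%:R / S%:R.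
Proof.
move=> S0 init amax step HV HD Htail mS m2 Nm.
have S0' : 0 < S%:R :> R by rewrite ltr0n.
move=> /andP [y0 ym]; set k := (_ %/ _)%N => k30.
have Sy : (4 * S <= y)%N.
  have := ltn_ceil (64 * m) y0; rewrite -/k => mk.
  have : (k.+1 * y <= 1920 * y)%N by rewrite leq_mul2r k30 orbT.
  by clear -mk mS; lia.
have y66 : (66 <= y)%N.
  have := ltn_ceil (64 * m) y0; rewrite -/k => mk.
  have : (k.+1 * y <= 1920 * y)%N by rewrite leq_mul2r k30 orbT.
  by clear -mk m2; lia.
have cells := @grid_cells R S 324 A B 64 y S0 isT Sy init amax step.
have close i j l l' : (64 <= i < 324)%N -> (64 <= j < 324)%N ->
    (knot 64 y i <= l <= knot 64 y i.+1)%N -> (knot 64 y j <= l' <= knot 64 y j.+1)%N ->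
    forall d, (maxn (B i) (B i.+1) <= d + minn (A j) (A j.+1))%N ->
      (maxn (B j) (B j.+1) <= d + minn (A i) (A i.+1))%N ->
    y%:R * `|long_prop R l y - long_prop R l' y| <= d%:R / S%:R.
  move=> hi hj ki kj d dij dji.
  have /andP [l1 u1] := cells i l hi ki.
  have /andP [l2 u2] := cells j l' hj kj.
  rewrite -[y%:R]ger0_norm ?ler0n // -normrM mulrBr ler_pdivlMr // mulrC.
  rewrite -[S%:R]ger0_norm ?ler0n // -normrM mulrBr.
  move: dij dji; rewrite -!(ler_nat R) !natrD.
  move: l1 u1 l2 u2.
  move: (S%:R * _) (S%:R * _) ((minn _ _)%:R) ((minn _ _)%:R) ((maxn _ _)%:R) ((maxn _ _)%:R) (d%:R).
  clear=> *; by rewrite ler_norml; apply/andP; split; lra.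
have between a lo hi : (lo * y <= a < hi.+1 * y)%N -> (lo <= a %/ y <= hi)%N.
  by move=> /andP [h1 h2]; rewrite leq_divRL // h1 -ltnS ltn_divLR.
have k64 : (64 <= k)%N by rewrite /k leq_divRL // leq_mul2l ym orbT.
have [kl ku] : (k * y <= 64 * m /\ 64 * m < k.+1 * y)%N.
  by rewrite leq_trunc_div ltn_ceil.
have [k3|k3] := ltnP k 192; last first.
  have j2 : (2 < k %/ 64)%N by rewrite leq_divRL.
  have jk : ((k %/ 64) * 64 <= k)%N := leq_trunc_div k 64.
  have osc := @long_prop_osc_tail R y (V%:R / S%:R) y0.
  apply: le_trans (osc _ (k %/ 64)%N m.+1 (N - y)%N j2 _ _) _.
  - move=> l l' ll ll'; rewrite -ler_pdivlMl ?ltr0n //.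
    apply: (@long_prop_osc_window R (3 * y).+1) => // {ll ll'} {}l {}l' lw lw'.
    rewrite ler_pdivlMl ?ltr0n //.
    have cellV l0 : ((3 * y).+1 <= l0 <= (3 * y).+1 + y)%N ->
        (192 <= (64 * l0.-1) %/ y <= 256)%N.
      by move=> lw0; apply: between => //; lia.
    have i1 := cellV l lw; have i2 := cellV l' lw'.
    apply: (close ((64 * l.-1) %/ y)%N ((64 * l'.-1) %/ y)%N) => //; try lia.
    + by apply: knot_cell => //; lia.
    + by apply: knot_cell => //; lia.
    + move: i1 i2; move: ((64 * l.-1) %/ y)%N ((64 * l'.-1) %/ y)%N => i j hi hj.
      have := HV i j; have := HV i j.+1; have := HV i.+1 j; have := HV i.+1 j.+1; lia.
    move: i1 i2; move: ((64 * l.-1) %/ y)%N ((64 * l'.-1) %/ y)%N => i j hi hj.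
    have := HV j i; have := HV j i.+1; have := HV j.+1 i; have := HV j.+1 i.+1; lia.
  - by nia.
  - by nia.
  rewrite ler_pdivrMr ?ltr0n ?fact_gt0 // mulrAC [X in _ <= X]mulrAC.
  rewrite ler_wpM2r ?invr_ge0 // -!natrM ler_nat mulnC.
  by rewrite Htail.
have i2 : (2 * k - 64 <= (64 * (N - y).-1) %/ y <= 2 * k - 62)%N.
  by apply: between; clear -kl ku k64 y66 ym Nm; nia.
apply: (close k ((64 * (N - y).-1) %/ y)%N) => //; try lia.
- by have := @knot_cell 64 y m.+1 isT y0 isT.
- by apply: knot_cell => //; lia.
- move: i2; move: (_ %/ _)%N => j hj.
  have hk : (64 <= k < 192)%N by lia.
  have H1 i i' := HD k i i' hk.
  rewrite geq_max !addn_minr !leq_min.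
  by rewrite !H1 ?inE ?mem_iota ?eqxx ?orbT //; lia.
move: i2; move: (_ %/ _)%N => j hj.
have hk : (64 <= k < 192)%N by lia.
have H1 i i' := HD k i i' hk.
rewrite geq_max !addn_minr !leq_min.
by rewrite !H1 ?inE ?mem_iota ?eqxx ?orbT //; lia.
Qed.

Lemma kernel_contract (R : realType) : exists N0 : nat, forall N M,
  (N0 <= N)%N -> (N <= M.*2 <= N.+1)%N ->
  \sum_(y < M.-1) `|long_prop R M y.+1 - long_prop R (N - y.+1) y.+1| / y.+1%:R ^+ 2
    <= 9 / 10 / N%:R ^+ 2.
Proof.
have [S [V [A [B [D [E [S0 init amax step [HV HD Htail HE Hsum]]]]]]]] := grid_certificate.
have S0' : 0 < S%:R :> R by rewrite ltr0n.
have [c c0 cE] : exists2 c : R, 0 <= c & c = 171 by exists 171; rewrite ?ler0n.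
have [s2 s2E] : exists s2 : R, s2 =
  \sum_(64 <= k < 30 * 64) (D k)%:R / S%:R * k.+1%:R ^+ 3 by eexists.
have [t0 s2t0] : exists t0 : nat, `|s2| <= t0%:R.
  by exists (Num.truncn `|s2|).+1; exact: ltW (truncnS_gt _).
pose N0 := (5000 * (S + 1 + t0))%N.
exists N0 => N M N0N /andP [NM MN].
have [m Mm] : exists m, M = m.+1 by exists M.-1; lia.
have [m0 mS t0m m2000 N2m] : [/\ (0 < m)%N, (120 * S <= m)%N, (t0 <= m)%N, (2000 <= m)%N
    & (2 * m + 1 <= N <= 2 * m + 2)%N].
  by clear -N0N NM MN Mm; rewrite /N0 in N0N; split; lia.
rewrite Mm /=.
pose f y := `|long_prop R m.+1 y - long_prop R (N - y) y|.
have near y : (0 < y <= m)%N -> ((64 * m) %/ y < 30 * 64)%N ->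
    y%:R * f y <= (D ((64 * m) %/ y)%N)%:R / S%:R.
  exact: kernel_near S0 init amax step HV HD Htail mS m2000 N2m.
have far y : (0 < y <= m)%N -> (30 * y <= m)%N -> f y <= c * y%:R ^+ 4 / m%:R ^+ 5.
  move=> /andP [y0 ym] _; rewrite cE.
  apply: le_trans (@long_prop_osc_pow R m y _ _ y0 m0 _ _) _ => //.
  by clear -ym N2m; lia.
have D0 k : 0 <= (D k)%:R / S%:R :> R by rewrite divr_ge0.
have := @block_sum R 64 30 m c (fun k => (D k)%:R / S%:R) f isT isT m0 c0 D0 near far.
move/le_trans; apply.
have m0' : 0 < m%:R :> R by rewrite ltr0n.
have S1le : \sum_(64 <= k < 30 * 64) (D k)%:R / S%:R * k.+1%:R ^+ 2 / k%:R <=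
    21 / 100 * 64 ^+ 2 :> R.
  apply: le_trans (_ : \sum_(64 <= k < 30 * 64) (E k)%:R / S%:R <= _).
    apply: ler_sum_nat => k /andP [k64 _].
    have k0 : 0 < k%:R :> R by rewrite ltr0n; apply: leq_trans k64.
    rewrite ler_pdivrMr // mulrAC [X in _ <= X]mulrAC ler_wpM2r ?invr_ge0 //.
    by rewrite -natrX -!natrM ler_nat HE //; apply: leq_trans k64.
  rewrite -mulr_suml ler_pdivrMr // -natr_sum.
  have [t tE] : exists t, t = (\sum_(64 <= i < 30 * 64) E i)%N by eexists.
  have : (100 * t <= 21 * (S * 64 ^ 2))%N by rewrite tE; exact: Hsum.
  rewrite -tE -(ler_nat R) !natrM.
  by clear; move: (t%:R) (S%:R) => u v; lra.
have s2m : `|s2| <= m%:R.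
  by apply: le_trans s2t0 _; rewrite ler_nat.
have hm : 0 < 64 * m%:R :> R by rewrite mulr_gt0 // ltr0n.
have m100 : 100 <= m%:R :> R by rewrite ler_nat; apply: leq_trans m2000.
have Nm : N%:R <= 2 * m%:R + 2 :> R.
  by rewrite -natrM -natrD ler_nat; case/andP: N2m.
have N0' : 0 < N%:R :> R by rewrite ltr0n; clear -N2m; lia.
apply: le_trans (_ : 22 / 100 / m%:R ^+ 2 <= _).
  rewrite -s2E (_ : 22 / 100 / m%:R ^+ 2 = (21 / 100 * 64 ^+ 2) / (64 * m%:R) ^+ 2 +
    m%:R / (64 * m%:R) ^+ 3 + (1 / 100 - 1 / 64 ^+ 3) / m%:R ^+ 2); last first.
    by field; rewrite gt_eqF.
  rewrite !lerD //.
  - by rewrite ler_wpM2r ?invr_ge0 ?exprn_ge0 // ltW.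
  - rewrite ler_wpM2r ?invr_ge0 ?exprn_ge0 ?(ltW hm) //.
    by apply: le_trans s2m; rewrite ler_norm.
  rewrite ler_wpM2r ?invr_ge0 ?exprn_ge0 //.
  by clear -cE; rewrite cE; lra.
rewrite ler_pdivrMr ?exprn_gt0 // mulrAC ler_pdivlMr ?exprn_gt0 //.
move: m0' m100 Nm N0'; clear; move: (m%:R) (N%:R) => x n x0 x100 nx n0.
have : n ^+ 2 <= (2 * x + 2) ^+ 2 by rewrite lerXn2r ?nnegrE //; lra.
by nra.
Qed.

(** * The renewal equation *)

Lemma sum_antidiagonal (V : nmodType) (F : nat -> nat -> V) A :
  \sum_(m < A) \sum_(i < A - m) F m i = \sum_(n < A) \sum_(m < n.+1) F m (n - m)%N.
Proof.
elim: A => [|A IH]; first by rewrite !big_ord0.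
rewrite [RHS]big_ord_recr /= -IH.
transitivity (\sum_(m < A.+1) (\sum_(i < A - m) F m i + F m (A - m)%N)).
  by apply: eq_bigr => m _; rewrite subSn -1?ltnS // big_ord_recr.
by rewrite big_split /= big_ord_recr /= subnn big_ord0 addr0.
Qed.

Lemma practical_long_sum (R : realType) M : (0 < M)%N ->
  \sum_(m < M.-1) practical_prop R m * long_prop R M m.+1 = 1 - M%:R^-1.
Proof.
move=> M0; have M0' : M%:R != 0 :> R by rewrite pnatr_eq0; lia.
apply: (mulfI M0'); rewrite mulrBr mulr1 divff // mulr_sumr.
transitivity (\sum_(m < M.-1) \sum_(i < M.-1 - m) practical_prop R m * long_prop R i m.+1).
  apply: eq_bigr => m _; rewrite mulrCA long_prop_prefix mulr_sumr.
  by rewrite (_ : (M - m.+1 = M.-1 - m)%N) //; lia.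
rewrite (sum_antidiagonal (fun m i => practical_prop R m * long_prop R i m.+1)).
under eq_bigr => n _ do rewrite first_gap_sum.
by rewrite sumr_const card_ord -[in RHS](prednK M0) -natr1 addrK.
Qed.

Lemma long_prop_half (R : realType) N M y : (N <= M.*2)%N -> (M.-1 <= y)%N -> (y < N.-1)%N ->
  long_prop R (N - y.+1) y.+1 = 0.
Proof. by move=> NM My yN; apply: long_prop_short; lia. Qed.

Lemma sum_long_half (R : realType) N M (F : nat -> R) : (0 < M)%N -> (M <= N <= M.*2)%N ->
  \sum_(y < N.-1) F y * long_prop R (N - y.+1) y.+1 =
  \sum_(y < M.-1) F y * long_prop R (N - y.+1) y.+1.
Proof.
move=> M0 /andP [MN NM].
rewrite [RHS](big_ord_widen N.-1 (fun y => F y * long_prop R (N - y.+1) y.+1)); last by lia.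
rewrite [RHS]big_mkcond; apply: eq_bigr => y _; case: ltnP => // My.
by rewrite (@long_prop_half R N M) // mulr0.
Qed.

Lemma practical_rec (R : realType) N M : (0 < M)%N -> (M <= N <= M.*2)%N ->
  practical_prop R N.-1 = M%:R^-1 +
    \sum_(y < M.-1) practical_prop R y * (long_prop R M y.+1 - long_prop R (N - y.+1) y.+1).
Proof.
move=> M0 MN; have N0 : (0 < N)%N by lia.
under eq_bigr => y _ do rewrite mulrBr.
rewrite sumrB practical_long_sum // -sum_long_half //.
have := first_gap_sum R N.-1; rewrite big_ord_recr /= subnn long_prop0 mulr1.
have shift y : (N.-1 - y = N - y.+1)%N by lia.
under eq_bigr => y _ do rewrite shift.
by move: (\sum_(i < _) _) => s E; lra.
Qed.

Lemma practical_prop_rate (R : realType) (g B : R) : g < 1 ->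
  (forall N, (0 < N)%N -> `|N%:R * long_limit R N - g| <= B / N%:R) ->
  exists K : R, forall n, `|practical_prop R n - (1 - g)^-1 / n.+1%:R| <= K / n.+1%:R ^+ 2.
Proof.
move=> g1 /kernel_sum [K0 HK]; have [N0 HN] := kernel_contract R.
have [C C0 [Cg ->]] : exists2 C, 0 < C & C * (1 - g) = 1 /\ (1 - g)^-1 = C.
  by exists (1 - g)^-1; rewrite ?invr_gt0 ?subr_gt0 // mulVf // gt_eqF // subr_gt0.
pose e n := practical_prop R n - C / n.+1%:R.
pose K1 := \sum_(n < N0) `|e n| * n.+1%:R ^+ 2.
pose K := K1 + 10 * C * `|K0|.
have K10 : 0 <= K1 by apply: sumr_ge0 => i _; rewrite mulr_ge0.
have CK0 : 0 <= C * `|K0| by rewrite mulr_ge0 // ltW.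
have K0' : 0 <= K by rewrite /K -mulrA addr_ge0 // mulr_ge0.
exists K; elim/ltn_ind => n IH; rewrite -/(e n).
have [nN0|N0n] := ltnP n N0.
  rewrite ler_pdivlMr ?exprn_gt0 ?ltr0n // /K -mulrA -[X in X <= _]addr0 lerD //; last first.
    by rewrite mulr_ge0.
  rewrite /K1 (bigD1 (Ordinal nN0)) //= lerDl.
  by apply: sumr_ge0 => i _; rewrite mulr_ge0.
set N := n.+1; pose M := n./2.+1.
have NM : (N <= M.*2 <= N.+1)%N by rewrite /N /M; clear; lia.
have MN : (M <= N <= M.*2)%N by rewrite /N /M; clear; lia.
have M0 : (0 < M)%N by [].
have := HN N M (leqW N0n) NM.
have := HK N M M0 MN.
set D := fun y : nat => long_prop R M y.+1 - long_prop R (N - y.+1) y.+1.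
have -> : \sum_(y < N.-1) long_prop R (N - y.+1) y.+1 / y.+1%:R =
    \sum_(y < M.-1) long_prop R (N - y.+1) y.+1 / y.+1%:R.
  under eq_bigr => y _ do rewrite mulrC.
  by rewrite (@sum_long_half R N M (fun y => y.+1%:R^-1)) //; apply: eq_bigr => y _; rewrite mulrC.
rewrite -sumrB; under eq_bigr => y _ do rewrite -mulrBl.
move=> kernel contract.
have eE : e n = C * (\sum_(y < M.-1) D y / y.+1%:R - (N%:R^-1 - (1 - g) / M%:R)) +
    \sum_(y < M.-1) e y * D y.
  have -> : C * (\sum_(y < M.-1) D y / y.+1%:R - (N%:R^-1 - (1 - g) / M%:R)) =
      C * \sum_(y < M.-1) D y / y.+1%:R - C / N%:R + M%:R^-1.
    have Cv v : C * ((1 - g) * v) = v by rewrite mulrA Cg mul1r.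
    by rewrite -[in RHS](Cv M%:R^-1); clear; ring.
  have -> : \sum_(y < M.-1) (practical_prop R y - C / y.+1%:R) * D y =
      \sum_(y < M.-1) practical_prop R y * D y - C * \sum_(y < M.-1) D y / y.+1%:R.
    rewrite mulr_sumr -sumrB; apply: eq_bigr => y _.
    by rewrite mulrBl; congr (_ - _); rewrite mulrAC mulrA.
  rewrite /e -[n]/N.-1 (practical_rec R M0 MN) -/N; ring.
rewrite eE; apply: le_trans (ler_normD _ _) _.
have -> : K / N%:R ^+ 2 = C * (`|K0| / N%:R ^+ 2) + (K - C * `|K0|) / N%:R ^+ 2.
  by rewrite mulrBl mulrA; ring.
apply: lerD.
  rewrite normrM (ger0_norm (ltW C0)) ler_wpM2l ?(ltW C0) //.
  by apply: le_trans kernel _; rewrite ler_wpM2r ?invr_ge0 ?exprn_ge0 ?ler0n // ler_norm.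
apply: le_trans (ler_norm_sum _ _ _) _.
apply: le_trans (_ : K * (9 / 10 / N%:R ^+ 2) <= _); last first.
  rewrite mulrA ler_wpM2r ?invr_ge0 ?exprn_ge0 ?ler0n //.
  move: K10 CK0; rewrite /K -[10 * C * _]mulrA; move: (C * _) (K1) => a b; clear; lra.
apply: le_trans (ler_wpM2l K0' contract); rewrite mulr_sumr; apply: ler_sum => y _.
rewrite normrM mulrA mulrAC ler_wpM2r ?normr_ge0 //.
by apply: IH; have := ltn_ord y; rewrite /M /=; lia.
Qed.

(** * Euler's constant *)

Definition atanh_sum (R : realType) n (z : R) : R :=
  \sum_(j < n) 2 * z ^+ j.*2.+1 / j.*2.+1%:R.

Lemma is_derive_ln_ratio (R : realType) (t : R) : 0 <= t < 1 ->
  is_derive t 1 (fun x => ln (1 + x) - ln (1 - x)) (2 / (1 - t ^+ 2)).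
Proof.
move=> /andP [t0 t1].
have d1 : is_derive t 1 (fun x : R => ln (1 + x)) (1 + t)^-1.
  have := @is_derive1_comp R (@ln R) (fun x => 1 + x) t (1 + t)^-1 1.
  rewrite mulr1; apply; first by apply: is_derive1_ln; lra.
  by have := is_deriveD (is_derive_cst (1 : R) t 1) (is_derive_id t 1); rewrite add0r.
have d2 : is_derive t 1 (fun x : R => ln (1 - x)) (- (1 - t)^-1).
  have := @is_derive1_comp R (@ln R) (fun x => 1 - x) t (1 - t)^-1 (-1).
  rewrite mulrN1; apply; first by apply: is_derive1_ln; lra.
  by have := is_deriveB (is_derive_cst (1 : R) t 1) (is_derive_id t 1); rewrite sub0r.
suff -> : 2 / (1 - t ^+ 2) = (1 + t)^-1 - - (1 - t)^-1 by exact: is_deriveB.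
have h1 : 1 + t != 0 by lra.
have h2 : 1 - t != 0 by lra.
have h3 : 1 - t ^+ 2 != 0 by rewrite (_ : 1 - t ^+ 2 = (1 - t) * (1 + t)) ?mulf_neq0 //; ring.
by field; rewrite h1 h2 h3.
Qed.

Lemma ln_ratio_MVT (R : realType) (p : {poly R}) (z : R) : 0 <= z < 1 -> p.[0] = 0 ->
  exists2 c, 0 <= c <= z &
    ln ((1 + z) / (1 - z)) - p.[z] = (2 / (1 - c ^+ 2) - p^`().[c]) * z.
Proof.
move=> /andP [z0 z1] p0.
pose f (x : R) : R := ln (1 + x) - ln (1 - x) - p.[x].
pose df (t : R) : R := 2 / (1 - t ^+ 2) - p^`().[t].
have D t : t \in `[0, z] -> is_derive t 1 f (df t).
  rewrite in_itv /= => /andP [t0 tz].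
  have /is_derive_ln_ratio ? : 0 <= t < 1 by rewrite t0; lra.
  exact: is_deriveB.
have D1 t : t \in `]0, z[ -> is_derive t 1 f (df t).
  by move=> tz; apply: D; exact: subset_itv_oo_cc tz.
have fc : {within `[0, z], continuous f}%classic.
  by apply: derivable_within_continuous => t /D [].
have [c cz E] := MVT_segment z0 D1 fc.
exists c; first by move: cz; rewrite in_itv.
move: E; rewrite /f p0 addr0 !subr0 subrr subr0 => <-.
by rewrite ln_div ?posrE; lra.
Qed.

Lemma atanh_sum_bounds (R : realType) n (z : R) : 0 <= z < 1 ->
  atanh_sum n z <= ln ((1 + z) / (1 - z)) <=
    atanh_sum n z + 2 * z ^+ n.*2.+1 / (n.*2.+1%:R * (1 - z ^+ 2)).
Proof.
move=> /andP [z0 z1].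
pose p (c : R) : {poly R} := \sum_(j < n) (2 / j.*2.+1%:R) *: 'X^(j.*2.+1) + c *: 'X^(n.*2.+1).
have pE c x : (p c).[x] = atanh_sum n x + c * x ^+ n.*2.+1.
  rewrite /p hornerD horner_sum !hornerE; congr (_ + _).
  by apply: eq_bigr => j _; rewrite !hornerE mulrAC.
have p0 c : (p c).[0] = 0.
  rewrite pE expr0n mulr0 addr0 /atanh_sum big1 // => j _.
  by rewrite expr0n mulr0 mul0r.
have dpE c t : (p c)^`().[t] * (1 - t ^+ 2) =
    2 - 2 * t ^+ n.*2 + c * n.*2.+1%:R * t ^+ n.*2 * (1 - t ^+ 2).
  rewrite /p derivD raddf_sum derivZ derivXn hornerD horner_sum mulrDl.
  congr (_ + _); last by rewrite hornerZ hornerMn hornerXn /= -(mulr_natr (t ^+ _)); ring.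
  transitivity (2 * ((1 - t ^+ 2) * \sum_(j < n) (t ^+ 2) ^+ j)).
    rewrite mulrCA mulrC [in RHS]mulr_sumr; congr (_ * _).
    apply: eq_bigr => j _; rewrite /= derivZ derivXn hornerZ hornerMn hornerXn /= -(mulr_natr (t ^+ _)).
    by rewrite mulrA mulrAC divfK ?pnatr_eq0 // -exprM mul2n.
  by rewrite -opprB mulNr -subrX1 -exprM mul2n; ring.
have pos c : 0 <= c <= z -> 0 < 1 - c ^+ 2.
  by move=> /andP [c0 cz]; rewrite subr_gt0 expr_lt1 //; lra.
have zz : 0 < 1 - z ^+ 2 by apply: pos; rewrite z0 lexx.
apply/andP; split.
  have [||c cz E] := @ln_ratio_MVT R (p 0) z; rewrite ?z0 //.
  have := pos c cz => c2; move: cz => /andP [c0 cz].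
  have -> : atanh_sum n z = (p 0).[z] by rewrite pE mul0r addr0.
  rewrite -subr_ge0 E mulr_ge0 // subr_ge0 ler_pdivlMr // dpE !mul0r addr0.
  by rewrite gerBl mulr_ge0 // exprn_ge0.
pose c0 := 2 / (n.*2.+1%:R * (1 - z ^+ 2)) : R.
have [||c cz E] := @ln_ratio_MVT R (p c0) z; rewrite ?z0 //.
have := pos c cz => c2; move: cz => /andP [cp cz].
have -> : atanh_sum n z + 2 * z ^+ n.*2.+1 / (n.*2.+1%:R * (1 - z ^+ 2)) = (p c0).[z].
  by rewrite pE mulrAC.
rewrite -subr_le0 E mulr_le0_ge0 // subr_le0 ler_pdivrMr // dpE.
rewrite -addrA lerDl addrC subr_ge0 /c0.
have -> : 2 / (n.*2.+1%:R * (1 - z ^+ 2)) * n.*2.+1%:R * c ^+ n.*2 * (1 - c ^+ 2) =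
    2 * c ^+ n.*2 * ((1 - c ^+ 2) / (1 - z ^+ 2)).
  have : n.*2.+1%:R != 0 :> R by rewrite pnatr_eq0.
  by move: (n.*2.+1%:R) => d d0; field; rewrite d0 gt_eqF.
rewrite ler_peMr ?mulr_ge0 ?exprn_ge0 // ler_pdivlMr // mul1r lerD2l lerN2.
by rewrite lerXn2r ?nnegrE.
Qed.

Lemma ln_succ_bounds (R : realType) (x d : R) : 0 < x ->
  d = 1 / (2 * x) + 1 / (2 * (x + 1)) +
      1 / (12 * (x + 1) ^+ 2) - 1 / (12 * x ^+ 2) ->
  d <= ln (x + 1) - ln x <= d + (1 / x ^+ 4 - 1 / (x + 1) ^+ 4).
Proof.
move=> x0 dx; pose z := (2 * x + 1)^-1.
have z0 : 0 < z by rewrite invr_gt0; lra.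
have z1 : z < 1 by rewrite invf_lt1; lra.
have xE : x = (1 - z) / (2 * z) by rewrite /z; field; lra.
have x1E : x + 1 = (1 + z) / (2 * z) by rewrite xE; field; lra.
have lnE : ln (x + 1) - ln x = ln ((1 + z) / (1 - z)).
  rewrite -ln_div ?posrE; [|lra..]; congr ln; rewrite xE; field; lra.
have h1 : 0 < 1 - z by lra.
have h2 : 0 < 1 + z by lra.
have h : 0 < 1 - z ^+ 2.
  by rewrite (_ : 1 - z ^+ 2 = (1 - z) * (1 + z)) ?mulr_gt0 //; ring.
have w1 : z ^+ 2 <= 1 by lra.
have w0 : 0 <= z ^+ 2 by exact: sqr_ge0.
have dE : d = 2 * z + 2 / 3 * z ^+ 3 -
    2 / 3 * z ^+ 5 * (1 + z ^+ 2) / (1 - z ^+ 2) ^+ 2.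
  by rewrite dx x1E xE; field; rewrite !gt_eqF.
have sE : atanh_sum 2 z = 2 * z + 2 / 3 * z ^+ 3.
  rewrite /atanh_sum !big_ord_recl big_ord0 /= /bump /=.
  by rewrite -[0.*2.+1]/1%N -[(1 + 0).*2.+1]/3%N; field.
have /andP [lo hi] := @atanh_sum_bounds R 2 z ltac:(lra).
rewrite lnE; apply/andP; split.
  apply: le_trans lo; rewrite sE dE gerBl.
  rewrite divr_ge0 ?(exprn_ge0 _ (ltW h)) // !mulr_ge0 ?(exprn_ge0 _ (ltW z0)) //; lra.
apply: le_trans hi _; rewrite sE -subr_ge0.
have -> : d + (1 / x ^+ 4 - 1 / (x + 1) ^+ 4) -
    (2 * z + 2 / 3 * z ^+ 3 + 2 * z ^+ 2.*2.+1 / (2.*2.+1%:R * (1 - z ^+ 2))) =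
    2 * z ^+ 5 * (64 * (1 + z ^+ 2) -
      ((1 + z ^+ 2) / 3 + (1 - z ^+ 2) / 5) * (1 - z ^+ 2) ^+ 2) / (1 - z ^+ 2) ^+ 4.
  by rewrite dE x1E xE -[2.*2.+1]/5%N; field; rewrite !gt_eqF.
rewrite divr_ge0 ?(exprn_ge0 _ (ltW h)) // mulr_ge0 ?mulr_ge0 ?exprn_ge0 ?(ltW z0) //.
move: w0 w1; clear; move: (z ^+ 2) => w w0 w1; rewrite subr_ge0.
have : 0 <= (1 - w) ^+ 2 <= 1 by rewrite sqr_ge0 expr_le1 //; lra.
by move: ((1 - w) ^+ 2) => v /andP [v0 v1]; nra.
Qed.

Definition euler_seq (R : realType) (n : nat) : R := series (@harmonic R) n - ln n%:R.

Definition euler_corr (R : realType) (n : nat) : R :=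
  euler_seq R n - 1 / (2 * n%:R) + 1 / (12 * n%:R ^+ 2).

Lemma euler_corr_bounds (R : realType) n m : (0 < n)%N -> (n <= m)%N ->
  euler_corr R m <= euler_corr R n <= euler_corr R m + (1 / n%:R ^+ 4 - 1 / m%:R ^+ 4).
Proof.
move=> n0; elim: m => [|m IH]; first by rewrite leqn0 => /eqP nE; rewrite nE in n0.
rewrite leq_eqVlt => /predU1P [<-|]; first by rewrite subrr addr0 lexx.
rewrite ltnS => nm; have m0 : 0 < m%:R :> R by rewrite ltr0n (leq_trans n0).
have /andP [l1 u1] := IH nm.
have [d dE] : exists d : R, d = 1 / (2 * m%:R) + 1 / (2 * (m%:R + 1)) +
  1 / (12 * (m%:R + 1) ^+ 2) - 1 / (12 * m%:R ^+ 2) by eexists.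
have /andP [l2 u2] := ln_succ_bounds m0 dE.
have E : euler_corr R m - euler_corr R m.+1 = ln (m%:R + 1) - ln m%:R - d.
  rewrite dE /euler_corr /euler_seq series_harmonicS -!(natr1 m).
  by field; rewrite !gt_eqF //; lra.
move: E l1 u1 l2 u2; rewrite -(natr1 m); clear.
move: (euler_corr R m) (euler_corr R m.+1) (euler_corr R n) (ln _) (ln _).
move: (1 / n%:R ^+ 4) (1 / m%:R ^+ 4) (1 / (m%:R + 1) ^+ 4).
by move=> *; apply/andP; split; lra.
Qed.

Lemma euler_corr_gamma (R : realType) n : (0 < n)%N ->
  euler_gamma R <= euler_corr R n <= euler_gamma R + 1 / n%:R ^+ 4.
Proof.
have pow4 N : (0 < N)%N -> 1 / N%:R ^+ 4 <= 1 / N%:R :> R.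
  move=> N0; rewrite !div1r lef_pV2 ?posrE ?exprn_gt0 ?ltr0n //.
  by rewrite ler_eXnr // ler1n.
have near N k : (0 < N)%N -> (N <= k)%N ->
    euler_corr R N - 1 / N%:R ^+ 4 <= euler_corr R k <= euler_corr R N.
  move=> N0 Nk; have /andP [l u] := euler_corr_bounds R N0 Nk; rewrite l andbT.
  have : 0 <= 1 / k%:R ^+ 4 :> R by rewrite divr_ge0.
  by move: u; clear; move: (1 / _) (1 / _) => a b; lra.
have H N k k' : (0 < N)%N -> (N <= k)%N -> (N <= k')%N ->
    `|euler_corr R k - euler_corr R k'| <= 1 / N%:R.
  move=> N0 Nk Nk'; have := pow4 N N0.
  have /andP [l u] := near N k N0 Nk; have /andP [l' u'] := near N k' N0 Nk'.
  move: l u l' u'; clear; move: (1 / _) (1 / _) => a b *.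
  by rewrite ler_norml; apply/andP; split; lra.
have [l hl] := cauchy_rate H.
have {}hl k : (0 < k)%N -> `|euler_corr R k - l| <= 1 / k%:R.
  by move=> k0; apply: (hl _ k k) => // i j; exact: H.
have bnd N : (0 < N)%N -> l <= euler_corr R N <= l + 1 / N%:R ^+ 4.
  move=> N0; suff HH M : (0 < M)%N -> l - euler_corr R N <= 1 / M%:R /\
      euler_corr R N - (l + 1 / N%:R ^+ 4) <= 1 / M%:R.
    by apply/andP; split; rewrite -subr_le0; apply: (@le_div_nat_eq0 _ _ 1) => M /HH [].
  move=> M0; have MN : (0 < maxn M N)%N by rewrite leq_max M0.
  have := hl _ MN; have /andP [] := near N (maxn M N) N0 (leq_maxr _ _).
  have : 1 / (maxn M N)%:R <= 1 / M%:R :> R.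
    by rewrite !div1r lef_pV2 ?posrE ?ltr0n // ler_nat leq_maxl.
  clear; move: (1 / _) (1 / _) (1 / _) => a b c ab h1 h2.
  by rewrite ler_norml => /andP [h3 h4]; split; lra.
suff -> : euler_gamma R = l by exact: bnd.
rewrite /euler_gamma; apply: cvg_lim; first exact: Rhausdorff.
apply/cvgrPdist_le => e e0; exists (Num.truncn (2 / e)).+1 => // k /= ek.
have k0 : (0 < k)%N by apply: leq_trans ek.
have k0' : 0 < k%:R :> R by rewrite ltr0n.
apply: le_trans (_ : 2 / k%:R <= _); last first.
  rewrite ler_pdivrMr // mulrC -ler_pdivrMr //.
  by apply: le_trans (ltW (truncnS_gt _)) _; rewrite ler_nat.
have E : l - (series (@harmonic R) k - ln k%:R) =
    (l - euler_corr R k) - (1 / 2 - 1 / 12 / k%:R) / k%:R.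
  by rewrite /euler_corr /euler_seq; field; rewrite gt_eqF.
rewrite E; apply: le_trans (ler_normB _ _) _.
rewrite (_ : 2 / k%:R = 1 / k%:R + 1 / k%:R); last by ring.
rewrite distrC lerD ?hl // normrM [`|_^-1|]ger0_norm ?invr_ge0 ?ler0n //.
rewrite ler_wpM2r ?invr_ge0 ?ler0n //.
have : 0 <= (k%:R^-1 : R) <= 1 by rewrite invr_ge0 ler0n invf_le1 // ler1n.
clear; move: (k%:R^-1) => x /andP [x0 x1].
by rewrite ler_norml; apply/andP; split; lra.
Qed.

(* Decimals are cut into groups of three digits because numerals of [R] are unary. *)
Lemma ln2_bounds (R : realType) :
  693 / 10 ^+ 3 + 147 / 10 ^+ 6 + 180 / 10 ^+ 9 + 550 / 10 ^+ 12 <= ln (2 : R) <=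
  693 / 10 ^+ 3 + 147 / 10 ^+ 6 + 180 / 10 ^+ 9 + 570 / 10 ^+ 12.
Proof.
have z1 : 0 <= (1 / 3 : R) < 1 by lra.
have := atanh_sum_bounds 12 z1.
rewrite (_ : (1 + 1 / 3) / (1 - 1 / 3) = 2 :> R); last by field.
rewrite /atanh_sum !big_ord_recr big_ord0 /= /double /=.
rewrite (_ : _ / (25 * _) = 9 / 100 * (1 / 3) ^+ 25); last by field.
move: (ln 2) => l /andP [h1 h2]; apply/andP; split; lra.
Qed.

Lemma harmonic64_bounds (R : realType) :
  4 + 743 / 10 ^+ 3 + 890 / 10 ^+ 6 + 903 / 10 ^+ 9 + 700 / 10 ^+ 12 <=
  series (@harmonic R) 64%N <=
  4 + 743 / 10 ^+ 3 + 890 / 10 ^+ 6 + 903 / 10 ^+ 9 + 710 / 10 ^+ 12.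
Proof.
have series0 : series (@harmonic R) 0 = 0 by rewrite /series /= big_geq.
rewrite !series_harmonicS series0.
by apply/andP; split; lra.
Qed.

Lemma euler_gamma_bounds (R : realType) :
  577 / 10 ^+ 3 + 215 / 10 ^+ 6 + 500 / 10 ^+ 9 < euler_gamma R <
  577 / 10 ^+ 3 + 215 / 10 ^+ 6 + 666 / 10 ^+ 9.
Proof.
have := euler_corr_gamma R (isT : (0 < 64)%N).
have ln64 : ln (64%:R : R) = 6 * ln 2.
  by rewrite -[64%N]/(2 ^ 6)%N natrX lnXn ?ltr0n // mulr_natl.
rewrite /euler_corr /euler_seq ln64.
have := harmonic64_bounds R; have := ln2_bounds R.
move: (ln 2) (series _ _) (euler_gamma R) => l h g /andP [l1 l2] /andP [h1 h2] /andP [g1 g2].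
by apply/andP; split; lra.
Qed.

Lemma ln_ratio_quintic (R : realType) (z : R) : 0 <= z <= 1 / 10 ->
  2 * z + 2 / 3 * z ^+ 3 + 2 / 5 * z ^+ 5 <= ln ((1 + z) / (1 - z)) <=
  2 * z + 2 / 3 * z ^+ 3 + 2 / 5 * z ^+ 5 + 1 / 3 * z ^+ 7.
Proof.
move=> /andP [z0 z1]; have z01 : 0 <= z < 1 by lra.
have := atanh_sum_bounds 3 z01.
have -> : atanh_sum 3 z = 2 * z + 2 / 3 * z ^+ 3 + 2 / 5 * z ^+ 5.
  by rewrite /atanh_sum !big_ord_recr big_ord0 /= /double /=; field.
move=> /andP [-> h] /=; apply: le_trans h _; rewrite lerD2l /double /=.
have w : z ^+ 2 <= 1 / 100 by nra.
have v0 : 0 < 7 * (1 - z ^+ 2) by lra.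
rewrite ler_pdivrMr // (_ : _ * (7 * _) = z ^+ 7 * (7 / 3 * (1 - z ^+ 2))); last by ring.
by rewrite mulrC ler_wpM2l ?exprn_ge0 //; lra.
Qed.

Lemma expR_ln_half (R : realType) (x : R) : 0 < x -> expR (ln x - ln 2) = x / 2.
Proof. by move=> x0; rewrite -ln_div ?posrE ?lnK ?posrE ?divr_gt0. Qed.

Lemma constC_bounds (R : realType) :
  2 + 280 / 10 ^+ 3 + 291 / 10 ^+ 6 <= constC R < 2 + 280 / 10 ^+ 3 + 292 / 10 ^+ 6.
Proof.
have /andP [g1 g2] := euler_gamma_bounds R.
have /andP [l1 l2] := ln2_bounds R.
have e1 : expR (- euler_gamma R) < 1 by rewrite expR_lt1; lra.
(* Below, [z] is (c - 2)/(3 c - 2) up to rounding, [c] being the bound on [constC R];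
   then (1 + z)/(1 - z)/2 = 1 - 1/c. *)
have ratio0 (z : R) : 0 <= z <= 1 / 10 -> 0 < 1 - z /\ 0 < (1 + z) / (1 - z).
  by clear=> z01; split; [lra | rewrite divr_gt0 //; lra].
rewrite /constC; move: e1; set e := expR _ => e1; have d0 : 0 < 1 - e by rewrite subr_gt0.
apply/andP; split.
- pose z : R := 57 / 10 ^+ 3 + 900 / 10 ^+ 6 + 921 / 10 ^+ 9.
  have z01 : 0 <= z <= 1 / 10 by rewrite /z; clear; apply/andP; split; lra.
  have [z1 q0] := ratio0 z z01.
  have : (1 + z) / (1 - z) / 2 <= e.
    rewrite -expR_ln_half // ler_expR; have /andP [_ h] := ln_ratio_quintic z01.
    by move: h; move: (ln (_ / _)) => t h; move: l1 l2 g1 g2 h; rewrite /z; clear; lra.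
  rewrite ler_pdivrMr // ler_pdivrMr // => h.
  suff: (2 + 280 / 10 ^+ 3 + 291 / 10 ^+ 6) * (1 - e) <= 1 by rewrite -ler_pdivlMr // div1r.
  by move: h; rewrite /z; clear; lra.
pose z : R := 57 / 10 ^+ 3 + 901 / 10 ^+ 6 + 90 / 10 ^+ 9.
have z01 : 0 <= z <= 1 / 10 by rewrite /z; clear; apply/andP; split; lra.
have [z1 q0] := ratio0 z z01.
have : e < (1 + z) / (1 - z) / 2.
  rewrite -expR_ln_half // ltr_expR; have /andP [h _] := ln_ratio_quintic z01.
  by move: h; move: (ln (_ / _)) => t h; move: l1 l2 g1 g2 h; rewrite /z; clear; lra.
rewrite ltr_pdivlMr // ltr_pdivlMr // => h.
suff: 1 < (2 + 280 / 10 ^+ 3 + 292 / 10 ^+ 6) * (1 - e) by rewrite -ltr_pdivrMr // div1r.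
by move: h; rewrite /z; clear; lra.
Qed.

Lemma expR_dist_le (R : realType) (a b : R) : a <= 0 -> b <= 0 ->
  `|expR a - expR b| <= `|a - b|.
Proof.
have H (x y : R) : x <= 0 -> y <= x -> expR x - expR y <= x - y.
  move=> x0 yx; have ex1 : expR x <= 1 by rewrite expR_le1.
  have : expR y = expR x * expR (y - x) by rewrite -expRD addrC subrK.
  have := expR_ge1Dx (y - x); have := expR_ge0 x.
  by move: ex1 yx; clear; move: (expR x) (expR y) (expR _) => *; nra.
move=> a0 b0; case: (leP a b) => ab.
  by rewrite distrC [X in _ <= X]distrC !ger0_norm ?subr_ge0 ?ler_expR ?H.
by rewrite !ger0_norm ?subr_ge0 ?ler_expR ?H // ltW.
Qed.

Lemma long_limit_gamma (R : realType) N : (0 < N)%N ->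
  `|N%:R * long_limit R N - expR (- euler_gamma R)| <= 2 / N%:R.
Proof.
move=> N0; have N0' : 0 < N%:R :> R by rewrite ltr0n.
have E : N%:R * long_limit R N = expR (- euler_seq R N).
  by rewrite /euler_seq opprB expRD lnK ?posrE.
have u0 : - euler_seq R N <= 0.
  rewrite -expR_le1 -E mulrC -ler_pdivlMr // div1r.
  by apply: le_trans (long_limit_le R N) _; rewrite lef_pV2 ?posrE ?ltr0n // ler_nat.
rewrite E; apply: le_trans (expR_dist_le u0 _) _.
  by have /andP [] := euler_gamma_bounds R; lra.
rewrite opprK addrC.
have N1 : 0 <= (N%:R^-1 : R) <= 1 by rewrite invr_ge0 ler0n invf_le1 // ler1n.
have : 1 / N%:R ^+ 4 <= N%:R^-1 :> R.
  by rewrite div1r lef_pV2 ?posrE ?exprn_gt0 // ler_eXnr // ler1n.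
have /andP [] := euler_corr_gamma R N0.
rewrite /euler_corr (_ : 1 / (2 * N%:R) = N%:R^-1 / 2); last by field; rewrite gt_eqF.
rewrite (_ : 1 / (12 * N%:R ^+ 2) = N%:R^-1 * N%:R^-1 / 12); last by field; rewrite gt_eqF.
move: N1; clear; move: (N%:R^-1) (1 / _) (euler_seq R N) (euler_gamma R) => x y u g.
by move=> /andP [x0 x1] *; rewrite ler_norml; apply/andP; split; nra.
Qed.

Theorem theorem1p4 (R : realType) :
  (exists (K : R) (eps : nat -> R),
    forall n : nat, (1 <= n)%N ->
      `|eps n| <= K / n%:R /\
      proportion R n = constC R / n%:R * (1 + eps n)) /\
  (2 + 280 / 10 ^+ 3 + 291 / 10 ^+ 6 <= constC R
     < 2 + 280 / 10 ^+ 3 + 292 / 10 ^+ 6).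
Proof.
split; last exact: constC_bounds.
have g1 : expR (- euler_gamma R) < 1.
  by rewrite expR_lt1; have /andP [] := euler_gamma_bounds R; lra.
have [K HK] := practical_prop_rate g1 (@long_limit_gamma R).
have C0 : 0 < constC R by rewrite invr_gt0 subr_gt0.
exists (`|K| / constC R + 1), (fun n => n%:R * proportion R n / constC R - 1) => n n0.
have n0' : 0 < n%:R :> R by rewrite ltr0n.
split; last by field; rewrite !gt_eqF.
have := HK n; rewrite -/(constC R) proportionE; move: (practical_prop R n) => p Hp.
have -> : n%:R * p / constC R - 1 =
    n%:R / constC R * ((p - constC R / n.+1%:R) - constC R / (n%:R * n.+1%:R)).
  by rewrite -natr1; field; rewrite !gt_eqF //; lra.
rewrite normrM ger0_norm ?divr_ge0 ?(ltW C0) // mulrC -ler_pdivlMr ?divr_gt0 //.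
have nn : n%:R * n%:R <= n%:R * n.+1%:R :> R by rewrite ler_wpM2l // ler_nat.
have -> : (`|K| / constC R + 1) / n%:R / (n%:R / constC R) =
    `|K| / (n%:R * n%:R) + constC R / (n%:R * n%:R).
  by field; rewrite !gt_eqF.
apply: le_trans (ler_normB _ _) _; apply: lerD.
  apply: le_trans Hp _; apply: le_trans (_ : `|K| / n.+1%:R ^+ 2 <= _).
    by rewrite ler_wpM2r ?invr_ge0 ?exprn_ge0 // ler_norm.
  rewrite ler_wpM2l // lef_pV2 ?posrE ?exprn_gt0 ?mulr_gt0 ?ltr0n //.
  by rewrite -expr2 lerXn2r ?nnegrE // ler_nat.
rewrite ger0_norm ?divr_ge0 ?mulr_ge0 ?(ltW C0) // ler_wpM2l ?(ltW C0) //.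
by rewrite lef_pV2 ?posrE ?mulr_gt0 ?ltr0n.
Qed.
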